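(* Let $X_t=pt-\sum_{i=1}^{N_t}U_i$ be a Cramér–Lundberg process with $p>0$, $\{U_i\}$ i.i.d. exponential with parameter $\mu>0$, $\{N_t\}$ an independent Poisson process with intensity $\lambda>0$; let $q>0$, $r>0$, $0<\delta<p$. Write $q^\pm=q^\pm(q)$. The function $V^{(q)}$ has the following form. For $x>0$, $$V^{(q)}(x)=e^{qr}(p-\delta)\mathbb W^{(q)}(x)-\frac1{\mu\lambda}\big[(q+\lambda)\mathbb W^{(q)}(x)-(p-\delta)\mathbb W^{(q)\prime}(x)\big]\cdot\big[(q+\lambda)e^{qr}-pC\big],$$ where $$\begin{aligned}C=e^{-\lambda r}\Big[&pW^{(q)\prime}(pr)+A^-q^+e^{q^+pr}\sum_{m=0}^\infty\frac{(pr(q^-+\mu))^m}{m!(m+1)!}\gamma\big(m+1,(q^++\mu)pr\big)\big[pr(q^++\mu)-(m+1)\big]\\&-A^+q^-e^{q^-pr}\sum_{m=0}^\infty\frac{(pr(q^++\mu))^m}{m!(m+1)!}\gamma\big(m+1,(q^-+\mu)pr\big)\big[pr(q^-+\mu)-(m+1)\big]\\&+\frac{e^{-\mu pr}}{pr}\sum_{m=0}^\infty\frac{(p\lambda\mu r^2)^{m+1}}{m!(m+1)!}\Big].\end{aligned}$$ For $-pr\le x\le0$, $$\begin{aligned}V^{(q)}(x)=e^{-\lambda r}\Big[&pW^{(q)}(x+pr)\\&+A^-e^{q^+(x+pr)}\sum_{m=0}^\infty\frac{(pr(q^-+\mu))^m}{m!(m+1)!}\gamma\big(m+1,(pr+x)(q^++\mu)\big)\big[pr(q^++\mu)-(m+1)\big]\\&-A^+e^{q^-(x+pr)}\sum_{m=0}^\infty\frac{(pr(q^++\mu))^m}{m!(m+1)!}\gamma\big(m+1,(pr+x)(q^-+\mu)\big)\big[pr(q^-+\mu)-(m+1)\big]\Big].\end{aligned}$$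 For $x<-pr$, $V^{(q)}(x)=0$. Here $\gamma(a,x)=\int_0^xe^{-t}t^{a-1}dt$ is the (lower) incomplete gamma function.
   Context: Under $\mathbb P$, $X_0=0$. Set $q^\pm(q)=\frac{q+\lambda-\mu p\pm\sqrt{(q+\lambda-\mu p)^2+4pq\mu}}{2p}$, $A^\pm=\frac{\mu+q^\pm(q)}{q^+(q)-q^-(q)}$, and $q_Y^\pm(q)=\frac{q+\lambda-\mu(p-\delta)\pm\sqrt{(q+\lambda-\mu(p-\delta))^2+4(p-\delta)q\mu}}{2(p-\delta)}$, $A_Y^\pm=\frac{\mu+q_Y^\pm(q)}{q_Y^+(q)-q_Y^-(q)}$. The $q$-scale functions of $X$ and of $Y_t=X_t-\delta t$ are, for $x\ge0$, $W^{(q)}(x)=\frac1p(A^+e^{q^+(q)x}-A^-e^{q^-(q)x})$ and $\mathbb W^{(q)}(x)=\frac1{p-\delta}(A_Y^+e^{q_Y^+(q)x}-A_Y^-e^{q_Y^-(q)x})$, and both vanish for $x<0$. For $x,a\in\mathbb R$, $w^{(q)}(x;a)=W^{(q)}(x-a)$ if $x<0$ and $w^{(q)}(x;a)=W^{(q)}(x-a)+\delta\int_0^x\mathbb W^{(q)}(x-y)W^{(q)\prime}(y-a)dy$ if $x\ge0$. The Parisian refracted scale function is $V^{(q)}(x)=\int_0^\infty w^{(q)}(x;-z)\frac zr\mathbb P(X_r\in dz)$. *)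

(* Defs.v *)
From HB Require Import structures.
From mathcomp Require Import all_boot all_order all_algebra finmap.
From mathcomp Require Import all_classical all_reals all_analysis measurable_realfun.
Set Implicit Arguments.
Unset Strict Implicit.
Unset Printing Implicit Defensive.
Import Order.TTheory GRing.Theory Num.Theory.
Import numFieldNormedType.Exports.
Local Open Scope classical_set_scope.
Local Open Scope ring_scope.

Section Independence.
Context d (Omega : measurableType d) (R : realType) (P : probability Omega R).

Definition mutually_independent (I : choiceType) d' (T : measurableType d')
    (X : I -> Omega -> T) : Prop :=
  forall (J : {fset I}) (B : I -> set T), (forall i, measurable (B i)) ->
    P (\bigcap_(i in [set` J]) X i @^-1` B i) =
    (\prod_(i <- J) P (X i @^-1` B i))%E.

(* sigma(X_i : i in D) *)
Definition generated_sigma_algebra (I : Type) d' (T : measurableType d')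
    (D : set I) (X : I -> Omega -> T) : set (set Omega) :=
  <<s \bigcup_(i in D) [set X i @^-1` B | B in measurable] >>.

Definition independent_sigma_algebras (F G : set (set Omega)) : Prop :=
  forall A B, F A -> G B -> P (A `&` B) = (P A * P B)%E.

End Independence.

Section Processes.
Context d (Omega : measurableType d) (R : realType) (P : probability Omega R).

(* Processes are indexed by R, but only the times t >= 0 are ever constrained.
   The subtraction of the increments is truncated, which is harmless because
   almost all paths are nondecreasing. *)
Definition poisson_process (lam : R) (N : R -> {RV P >-> nat}) : Prop :=
  [/\ {ae P, forall w, N 0 w = 0%N},
      forall t : nat -> R, 0 <= t 0%N -> {homo t : i j / (i <= j)%N >-> i <= j} ->
        mutually_independent P (fun (i : nat) w => (N (t i.+1) w - N (t i) w)%N),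
      forall s t k, 0 <= s -> s < t ->
        P [set w | (N t w - N s w)%N = k] = (poisson_pmf (lam * (t - s)) k)%:E &
      {ae P, forall w,
        (forall s t, 0 <= s -> s <= t -> (N s w <= N t w)%N) /\
        (forall t, 0 <= t -> \forall s \near t^'+, N s w = N t w)} ].

(* The i-th claim (i >= 1) is U i.-1. *)
Definition iid_exponential (mu : R) (U : nat -> {RV P >-> R}) : Prop :=
  mutually_independent P (fun i w => U i w) /\
  forall i (B : set R), measurable B ->
    distribution P (U i) B = exponential_prob mu B.

Definition cramer_lundberg_inputs (lam mu : R)
    (N : R -> {RV P >-> nat}) (U : nat -> {RV P >-> R}) : Prop :=
  [/\ poisson_process lam N, iid_exponential mu U &
      independent_sigma_algebras P
        (generated_sigma_algebra [set t : R | 0 <= t] (fun t w => N t w))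
        (generated_sigma_algebra [set: nat] (fun i w => U i w))].

Definition cramer_lundberg (p : R) (N : R -> {RV P >-> nat})
    (U : nat -> {RV P >-> R}) (t : R) (w : Omega) : R :=
  p * t - \sum_(i < N t w) U i w.

Lemma measurable_cramer_lundberg p N U t :
  measurable_fun [set: Omega] (cramer_lundberg p N U t).
Proof.
have mS n : measurable_fun [set: Omega] (fun w => p * t - \sum_(i < n) U i w).
  by apply: measurable_funB => //; apply: measurable_sum => i.
move=> _ B mB; rewrite setTI.
have -> : cramer_lundberg p N U t @^-1` B =
    \bigcup_n (N t @^-1` [set n] `&`
               (fun w => p * t - \sum_(i < n) U i w) @^-1` B).
  apply/seteqP; split => [w Bw|w [n _ [/= <-]]//].
  by exists (N t w).
apply: bigcupT_measurable => n; apply: measurableI.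
  exact: measurable_funPTI.
by rewrite -[X in measurable X]setTI; exact: mS.
Qed.

HB.instance Definition _ p N U t :=
  isMeasurableFun.Build _ _ _ _ (cramer_lundberg p N U t)
    (measurable_cramer_lundberg p N U t).

End Processes.

Section ScaleFunctions.
Context (R : realType).
Implicit Types c p delta lam mu q r x a z : R.

(* In this section c is the drift: c = p for X, and c = p - delta for
   Y_t = X_t - delta t. *)
Definition root_disc c lam mu q : R :=
  (q + lam - mu * c) ^+ 2 + 4 * c * q * mu.

Definition root_plus c lam mu q : R :=
  (q + lam - mu * c + Num.sqrt (root_disc c lam mu q)) / (2 * c).

Definition root_minus c lam mu q : R :=
  (q + lam - mu * c - Num.sqrt (root_disc c lam mu q)) / (2 * c).

Definition coef_plus c lam mu q : R :=
  (mu + root_plus c lam mu q) / (root_plus c lam mu q - root_minus c lam mu q).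

Definition coef_minus c lam mu q : R :=
  (mu + root_minus c lam mu q) / (root_plus c lam mu q - root_minus c lam mu q).

Definition scale c lam mu q x : R :=
  if x < 0 then 0 else
    c^-1 * (coef_plus c lam mu q * expR (root_plus c lam mu q * x)
            - coef_minus c lam mu q * expR (root_minus c lam mu q * x)).

Definition refracted_scale p delta lam mu q x a : R :=
  let W := scale p lam mu q in
  let WY := scale (p - delta) lam mu q in
  if x < 0 then W (x - a) else
    W (x - a) +
    delta * \int[lebesgue_measure]_(y in `[0, x]) (WY (x - y) * W^`()%classic (y - a)).

(* Extended-real valued, so that equating it with a real number includes its
   finiteness; Xr stands for the random variable X_r. *)
Definition parisian_refracted_scale d (Omega : measurableType d)
    (P : probability Omega R) (Xr : {RV P >-> R}) p delta lam mu q r x : \bar R :=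
  (\int[distribution P Xr]_(z in `[0%R, +oo[)
     (refracted_scale p delta lam mu q x (- z) * (z / r))%:E)%E.

Definition lower_gamma (s x : R) : R :=
  \int[lebesgue_measure]_(t in `[0, x]) (expR (- t) * t `^ (s - 1)).

End ScaleFunctions.

(* Main.v *)
(** Given [n] claims, [p r - X_r] has the Erlang law of order [n], so the law of
    [X_r] is an atom at [p r] plus a series of Erlang densities with Poisson
    weights.  All scale functions are combinations of two exponentials, so every
    value of [V] reduces to the two moments [E(e^(s X_r) X_r / r; X_r >= a)],
    [s = q^+, q^-], which are series of incomplete gamma functions; the boundary
    terms of the integrations by parts cancel between the two roots because
    [A^+ / (q^+ + mu) = A^- / (q^- + mu)], or add up to the last series of [C].

    For [x > 0] the function [w(x; -z)] is [alpha(x) W(z) + beta(x) W'(z)], and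
    there remains the Kendall-type identity
    [int_0^oo W(z) z/r P(X_r in dz) = e^(q r)].  With [a, b = q^+ + mu, q^- + mu]
    and [u = p r], expanding both sides in powers of [u] turns it into
      [(a - b) (a + b)^N = sum_(2k <= N) (C(N, k) - C(N, k-1)) (ab)^k
                             (a^(N-2k+1) - b^(N-2k+1))]. *)
Require Import Defs.
From HB Require Import structures.
From mathcomp Require Import all_boot all_order all_algebra finmap.
From mathcomp Require Import all_classical all_reals all_analysis measurable_realfun.
From mathcomp Require Import ring lra zify.
Set Implicit Arguments.
Unset Strict Implicit.
Unset Printing Implicit Defensive.
Import Order.TTheory GRing.Theory Num.Theory.
Import numFieldNormedType.Exports.
Local Open Scope classical_set_scope.
Local Open Scope ring_scope.

(** * Independence of partial sums *)

Section PartialSums.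
Context d (Omega : measurableType d) (R : realType) (P : probability Omega R).
Variable U : nat -> {RV P >-> R}.

Definition partial_sum (n : nat) (w : Omega) : R := \sum_(i < n) U i w.

Lemma measurable_partial_sum n : measurable_fun [set: Omega] (partial_sum n).
Proof. exact: measurable_sum. Qed.

HB.instance Definition _ n :=
  isMeasurableFun.Build _ _ _ _ (partial_sum n) (measurable_partial_sum n).

Hypothesis indepU : mutually_independent P (fun i w => U i w).

Local Notation cyl J B := (\bigcap_(i in [set` J]) (U i) @^-1` B i).

Lemma measurable_cyl (J : {fset nat}) (B : nat -> set R) :
  (forall i, measurable (B i)) -> measurable (cyl J B).
Proof.
move=> mB; apply: fin_bigcap_measurable; first exact: finite_fset.
by move=> i _; exact: measurable_funPTI.
Qed.

Lemma cylU1 (n : nat) (J : {fset nat}) (B : nat -> set R) :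
  U n @^-1` B n `&` cyl J B = cyl (n |` J)%fset B.
Proof.
apply/seteqP; split=> w /=.
  by move=> [wn wJ] i /=; rewrite !inE => /orP[/eqP ->//|iJ]; exact: wJ.
by move=> h; split=> [|i iJ]; apply: h; rewrite /= !inE ?eqxx// iJ orbT.
Qed.

Lemma independent_cylU1 (n : nat) (J : {fset nat}) (B : nat -> set R) :
  n \notin J -> (forall i, measurable (B i)) ->
  P (U n @^-1` B n `&` cyl J B) = (P (U n @^-1` B n) * P (cyl J B))%E.
Proof.
by move=> nJ mB; rewrite cylU1 !indepU// big_fsetU1.
Qed.

(** Induction on [n], with a cylinder carried along so that [U n] can be moved into it. The
    induction hypothesis for the cylinder enlarged by index [n] gives the factorization on
    rectangles for the pair ([partial_sum n], [U n]). Uniqueness of product measures extends it to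
    the event that the sum of the two coordinates lies in [A]. *)
Lemma independent_partial_sum (n : nat) (J : {fset nat}) (B : nat -> set R)
    (A : set R) :
  (forall i, i \in J -> (n <= i)%N) -> (forall i, measurable (B i)) ->
  measurable A ->
  P (partial_sum n @^-1` A `&` cyl J B) =
  (P (partial_sum n @^-1` A) * P (cyl J B))%E.
Proof.
elim: n J B A => [|n IHn] J B A nJ mB mA.
  have [A0|A0] := pselect (A 0).
    rewrite (_ : _ @^-1` A = setT) ?setTI ?probability_setT ?mul1e//.
    by apply/seteqP; split=> // w _; rewrite /preimage/= /partial_sum big_ord0.
  rewrite (_ : _ @^-1` A = set0) ?set0I ?measure0 ?mul0e//.
  by apply/seteqP; split=> // w; rewrite /preimage/= /partial_sum big_ord0.
have mC := measurable_cyl J mB.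
pose phi (w : Omega) : R * R := (partial_sum n w, U n w).
have mphi : measurable_fun setT phi by exact: measurable_fun_pair.
pose pm := isMeasurableFun.Build _ _ _ _ phi mphi.
pose phi' : {mfun Omega >-> (R * R)%type} := HB.pack phi pm.
have nJn : n \notin J by apply/negP => /nJ; rewrite ltnn.
have rect (K : {fset nat}) : (forall i, i \in K -> (n < i)%N) ->
   forall A1 A2 : set R, measurable A1 -> measurable A2 ->
   P ((phi @^-1` (A1 `*` A2)) `&` cyl K B) =
   (P (partial_sum n @^-1` A1) * P (U n @^-1` A2) * P (cyl K B))%E.
  move=> nK A1 A2 mA1 mA2.
  (* Changing the set at index [n] leaves the cylinder over [K] as it is, since [n] is not in
     [K]. *)
  pose B' i := if i == n then A2 else B i.
  have mB' i : measurable (B' i) by rewrite /B'; case: ifP.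
  have nKn : n \notin K by apply/negP => /nK; rewrite ltnn.
  have BK : cyl K B = cyl K B'.
    apply: eq_bigcapr => i /= iK; rewrite /B'; case: eqP => // ei.
    by move: nKn; rewrite -ei iK.
  have Bn : U n @^-1` A2 = U n @^-1` B' n by rewrite /B' eqxx.
  rewrite BK Bn -muleA -(independent_cylU1 nKn mB') cylU1 -IHn//; last first.
    by move=> i; rewrite !inE => /orP[/eqP ->//|/nK/ltnW].
  by rewrite -cylU1 -Bn setIA.
(* The law of the partial sum is scaled by the probability of the cylinder. Its product with the law
   of [U n] is then to be compared with the joint law under [P] restricted to the cylinder ([h1]);
   [h2] is the same without the cylinder. *)
pose c : {nonneg R} := NngNum (fine_ge0 (measure_ge0 P (cyl J B))).
pose m1 := mscale c (distribution P (partial_sum n)).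
have cE : (c%:num%:E = P (cyl J B))%E by rewrite /= fineK// fin_num_measure.
have m1E X : (m1 X = P (cyl J B) * P (partial_sum n @^-1` X))%E.
  by rewrite -cE.
have h1 : forall X, measurable X -> (m1 \x distribution P (U n))%E X
    = pushforward (mrestr P mC) phi' X.
  apply: product_measure_unique => A1 A2 mA1 mA2.
  transitivity (P (phi @^-1` (A1 `*` A2) `&` cyl J B)); first by [].
  rewrite rect// -[RHS]/(m1 A1 * P (U n @^-1` A2))%E m1E.
  by rewrite [LHS]muleC muleA.
have h2 : forall X, measurable X ->
    (distribution P (partial_sum n) \x distribution P (U n))%E X
    = distribution P phi' X.
  apply: product_measure_unique => A1 A2 mA1 mA2.
  transitivity (P (phi @^-1` (A1 `*` A2))); first by [].
  have := rect fset0 _ A1 A2 mA1 mA2.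
  rewrite (_ : cyl fset0 B = setT) ?setIT ?probability_setT ?mule1; last first.
    by rewrite set_fset0 bigcap_set0.
  by apply => i; rewrite inE.
have mD : measurable [set x : R * R | A (x.1 + x.2)].
  have : measurable_fun setT (fun x : R * R => x.1 + x.2).
    exact: measurable_funD.
  by move=> /(_ measurableT A mA); rewrite setTI.
have DE : partial_sum n.+1 @^-1` A = phi @^-1` [set x : R * R | A (x.1 + x.2)].
  by apply/seteqP; split => w; rewrite /preimage/= /partial_sum big_ord_recr.
have h1D := h1 _ mD; have h2D := h2 _ mD.
rewrite {1}DE -[LHS]/(pushforward (mrestr P mC) phi' _) -h1D.
rewrite DE -[X in (X * _)%E]/(distribution P phi' _) -h2D.
rewrite muleC -cE /product_measure1 /m1.
rewrite [LHS]ge0_integral_mscale//; exact: measurable_fun_xsection.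
Qed.

End PartialSums.

(** * Integration against densities, translates and independent pairs *)

Section IntegralLemmas.
Local Open Scope ereal_scope.

Import HBNNSimple.

(** Monotone convergence along simple functions increasing to [f] on both sides; for a simple
    function the claim is the hypothesis on each level set. *)
Lemma ge0_integral_density d (T : measurableType d) (R : realType)
    (mu m : {measure set T -> \bar R}) (g : T -> R) :
  measurable_fun setT g -> (forall x, 0 <= g x)%R ->
  (forall A, measurable A -> m A = \int[mu]_(x in A) (g x)%:E) ->
  forall f : T -> \bar R, measurable_fun setT f -> (forall x, 0 <= f x) ->
  \int[m]_x f x = \int[mu]_x (f x * (g x)%:E).
Proof.
move=> mg g0 mE f mf f0; pose h := nnsfun_approx measurableT mf.
have mEg : measurable_fun setT (EFin \o g) by exact/measurable_EFinP.
have fE x : f x = lim (EFin \o h ^~ x @ \oo).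
  by apply/esym/cvg_lim => //; exact: cvg_nnsfun_approx.
transitivity (lim (\int[m]_x (h n x)%:E @[n --> \oo])).
  under eq_integral => x _ do rewrite fE.
  apply: monotone_convergence => //.
  - by move=> n; exact/measurable_EFinP.
  - by move=> n x _; rewrite lee_fin.
  - by move=> x _ a b ab; rewrite lee_fin; exact/lefP/nd_nnsfun_approx.
have fgE x : f x * (g x)%:E = lim ((h n x)%:E * (g x)%:E @[n --> \oo]).
  by apply/esym/cvg_lim => //; apply: cvgeZr => //; exact: cvg_nnsfun_approx.
under [in RHS]eq_integral => x _ do rewrite fgE.
rewrite [RHS]monotone_convergence//; first last.
- move=> x _ a b ab; rewrite lee_wpmul2r ?lee_fin//.
  exact/lefP/nd_nnsfun_approx.
- by move=> n x _; rewrite mule_ge0 ?lee_fin.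
- by move=> n; apply: emeasurable_funM => //; exact/measurable_EFinP.
congr (lim (_ @ \oo)); apply/funext => n.
transitivity (\sum_(y \in range (h n)) (y%:E * m (h n @^-1` [set y]))).
  by rewrite integralT_nnsfun sintegralE.
transitivity (\int[mu]_x (\sum_(y \in range (h n))
    ((y * \1_(h n @^-1` [set y]) x)%:E * (g x)%:E))); last first.
  apply: eq_integral => x _; rewrite -ge0_mule_fsuml; last first.
    by move=> y; exact: nnfun_muleindic_ge0.
  by rewrite fsumEFin// -(fimfunE _ x).
rewrite ge0_integral_fsum//; first last.
- move=> y x _.
  by apply: mule_ge0; [exact: nnfun_muleindic_ge0|rewrite lee_fin].
- by move=> y; apply: emeasurable_funM => //; exact/measurable_EFinP/measurable_funM.
apply: eq_fsbigr => y; rewrite inE => -[x _ <-].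
under eq_integral do rewrite EFinM -muleA.
rewrite ge0_integralZl_EFin//.
- rewrite mE//; congr (_ * _); rewrite integral_mkcond/=.
  apply: eq_integral => t _; rewrite patchE indicE.
  by case: (t \in _); rewrite ?mul1e ?mul0e.
- by move=> t _; rewrite mule_ge0 ?lee_fin.
- by apply: emeasurable_funM => //; exact/measurable_EFinP.
Qed.

(* [R] and [measurableTypeR R] carry the same sigma-algebra under different
   displays, so [X] is packed again before comparing its law with Lebesgue's. *)
Lemma ge0_integral_RV_density d (Omega : measurableType d) (R : realType)
    (P : probability Omega R) (X : {RV P >-> R}) (g : R -> R) :
  measurable_fun setT g -> (forall x, 0 <= g x)%R ->
  (forall A, measurable A ->
    distribution P X A = \int[lebesgue_measure]_(x in A) (g x)%:E) ->
  forall f : R -> \bar R, measurable_fun setT f -> (forall x, 0 <= f x) ->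
  \int[P]_w f (X w) = \int[lebesgue_measure]_x (f x * (g x)%:E).
Proof.
move=> mg g0 PE f mf f0.
have mX : measurable_fun setT (X : Omega -> measurableTypeR R).
  have mX : measurable_fun setT (X : Omega -> R) by [].
  by move=> mT A mA; exact: (mX mT A mA).
pose pm := isMeasurableFun.Build _ _ _ _ (X : Omega -> measurableTypeR R) mX.
pose X' : {mfun Omega >-> measurableTypeR R} :=
  HB.pack (X : Omega -> measurableTypeR R) pm.
rewrite -(ge0_integral_density (m := distribution P X') mg g0 PE mf f0).
by rewrite ge0_integral_pushforward.
Qed.

(** The image of Lebesgue measure under a translation gives half-open intervals their length, so it
    is Lebesgue measure by uniqueness. *)
Lemma ge0_integral_shift (R : realType) (t : R) (f : R -> \bar R) :
  measurable_fun setT f -> (forall x, 0 <= f x) ->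
  \int[lebesgue_measure]_s f (s + t)%R = \int[lebesgue_measure]_s f s.
Proof.
move=> mf f0; pose tr := (fun s => s + t)%R : measurableTypeR R -> measurableTypeR R.
have mtr : measurable_fun setT tr by exact: measurable_funD.
pose pm := isMeasurableFun.Build _ _ _ _ tr mtr.
pose tr' : {mfun measurableTypeR R >-> measurableTypeR R} := HB.pack tr pm.
transitivity (\int[pushforward lebesgue_measure tr']_s f s).
  by rewrite ge0_integral_pushforward.
apply: eq_measure_integral => A mA _; apply/esym.
apply: lebesgue_measure_unique => // _ [[a b]] _ <-.
rewrite /= /pushforward.
rewrite (_ : _ @^-1` _ = `](a - t)%R, (b - t)%R]%classic); last first.
  by apply/seteqP; split => x /=; rewrite !in_itv/= ltrBlDr lerBrDr.
rewrite !lebesgue_measure_itv/= !lte_fin ltrD2r; case: ifPn => // _.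
by rewrite -!EFinB; congr EFin; ring.
Qed.

(** The joint law agrees with the product law on rectangles, hence everywhere, and Tonelli's theorem
    applies. *)
Lemma ge0_integral_independent d d1 d2 (Omega : measurableType d)
    (T1 : measurableType d1) (T2 : measurableType d2) (R : realType)
    (P : probability Omega R) (X : {RV P >-> T1}) (Y : {RV P >-> T2}) :
  (forall A B, measurable A -> measurable B ->
    P (X @^-1` A `&` Y @^-1` B) = P (X @^-1` A) * P (Y @^-1` B)) ->
  forall f : T1 * T2 -> \bar R, measurable_fun setT f -> (forall x, 0 <= f x) ->
  \int[P]_w f (X w, Y w) =
  \int[distribution P X]_x \int[distribution P Y]_y f (x, y).
Proof.
move=> XY f mf f0.
pose phi (w : Omega) : T1 * T2 := (X w, Y w).
have mphi : measurable_fun setT phi by exact: measurable_fun_pair.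
pose pm := isMeasurableFun.Build _ _ _ _ phi mphi.
pose phi' : {mfun Omega >-> (T1 * T2)%type} := HB.pack phi pm.
transitivity (\int[distribution P phi']_z f z).
  by rewrite ge0_integral_distribution.
rewrite -fubini_tonelli1//; apply: eq_measure_integral => A mA _.
by apply/esym; apply: product_measure_unique => // A1 A2 mA1 mA2; exact: XY.
Qed.

End IntegralLemmas.

(** * Derivatives and the fundamental theorem *)

Section IsDerive.
Context (R : realType).
Implicit Types (f g : R -> R) (x : R).

Lemma is_derive1_cst (c x : R) : is_derive x 1 (fun=> c) 0.
Proof. exact: is_derive_cst. Qed.

Lemma is_derive1D f g x df dg : is_derive x 1 f df -> is_derive x 1 g dg ->
  is_derive x 1 (fun y => f y + g y) (df + dg).
Proof. by move=> hf hg; exact: is_deriveD. Qed.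

Lemma is_derive1N f x df : is_derive x 1 f df ->
  is_derive x 1 (fun y => - f y) (- df).
Proof. by move=> hf; exact: is_deriveN. Qed.

Lemma is_derive1M f g x df dg : is_derive x 1 f df -> is_derive x 1 g dg ->
  is_derive x 1 (fun y => f y * g y) (f x * dg + g x * df).
Proof. by move=> hf hg; exact: is_deriveM. Qed.

Lemma is_derive1_mull (c x : R) : is_derive x 1 ( *%R c) c.
Proof.
have := is_derive1M (is_derive1_cst c x) (is_derive_id x 1).
by rewrite mulr0 addr0 mulr1.
Qed.

Lemma is_derive1_addl (c x : R) : is_derive x 1 ( +%R c) 1.
Proof.
have := is_derive1D (is_derive1_cst c x) (is_derive_id x 1).
by rewrite add0r.
Qed.

Lemma is_derive1X f n x df : is_derive x 1 f df ->
  is_derive x 1 (fun y => f y ^+ n) (n%:R * f x ^+ n.-1 * df).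
Proof.
by move=> hf; have := is_deriveX n hf; rewrite exprfctE.
Qed.

Lemma is_derive1_expR f x df : is_derive x 1 f df ->
  is_derive x 1 (fun y => expR (f y)) (df * expR (f x)).
Proof.
move=> hf; rewrite mulrC; exact: (@is_derive1_comp _ expR f).
Qed.

Lemma is_derive1_eq f x df df' : is_derive x 1 f df -> df = df' ->
  is_derive x 1 f df'.
Proof. by move=> + <-. Qed.

Lemma is_derive_derivable f x df : is_derive x 1 f df -> derivable f x 1.
Proof. by case. Qed.

Lemma derivable_continuous f : (forall x, derivable f x 1) -> continuous f.
Proof. by move=> h x; exact/differentiable_continuous/derivable1_diffP. Qed.

End IsDerive.

(* [notypeclasses] keeps typeclass resolution from attacking the side goals. *)
Ltac derive1_rec := lazymatch goal with
  | |- is_derive _ _ (fun=> ?c) _ =>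
      notypeclasses refine (@is_derive1_cst _ _ _)
  | |- is_derive _ _ (fun y => y) _ =>
      notypeclasses refine (@is_derive_id _ _ _ _)
  | |- is_derive _ _ -%R _ =>
      notypeclasses refine (@is_deriveNid _ _ _ _)
  | |- is_derive _ _ ( *%R _) _ =>
      notypeclasses refine (@is_derive1_mull _ _ _)
  | |- is_derive _ _ ( +%R _) _ =>
      notypeclasses refine (@is_derive1_addl _ _ _)
  | |- is_derive _ _ (fun y => _ + _) _ =>
      notypeclasses refine (@is_derive1D _ _ _ _ _ _ _ _); derive1_rec
  | |- is_derive _ _ (fun y => - _) _ =>
      notypeclasses refine (@is_derive1N _ _ _ _ _); derive1_rec
  | |- is_derive _ _ (fun y => _ * _) _ =>
      notypeclasses refine (@is_derive1M _ _ _ _ _ _ _ _); derive1_rec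
  | |- is_derive _ _ (fun y => _ ^+ _) _ =>
      notypeclasses refine (@is_derive1X _ _ _ _ _ _); derive1_rec
  | |- is_derive _ _ (fun y => expR _) _ =>
      notypeclasses refine (@is_derive1_expR _ _ _ _ _); derive1_rec
  | h : forall x, is_derive x _ ?f _ |- is_derive _ _ ?f _ =>
      notypeclasses refine (h _)
  end.
Ltac derive1 :=
  notypeclasses refine (@is_derive1_eq _ _ _ _ _ _ _);
  [derive1_rec|rewrite /GRing.scale/=].
Ltac continuous1 :=
  apply: derivable_continuous => ?;
  notypeclasses refine (@is_derive_derivable _ _ _ _ _); derive1_rec.

Section FTC.
Context (R : realType).

Lemma integral_is_derive (f F : R -> R) (a b : R) : a <= b ->
  continuous f -> (forall x : R, is_derive x 1 F (f x)) ->
  (\int[lebesgue_measure]_(x in `[a, b]) (f x)%:E = (F b - F a)%:E)%E.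
Proof.
rewrite le_eqVlt => /predU1P[<-|ab] cf dF.
  by rewrite set_itv1 integral_set1 subrr.
have dF1 (x : R) : derivable F x 1 by case: (dF x).
have cF : continuous F.
  by move=> x; exact/differentiable_continuous/derivable1_diffP.
rewrite (@continuous_FTC2 _ _ F)//.
- exact: continuous_subspaceT.
- by split=> //; [exact/cvg_at_right_filter/cF|exact/cvg_at_left_filter/cF].
- by move=> x _; rewrite derive1E; exact: derive_val.
Qed.

Lemma Rintegral_is_derive (f F : R -> R) (a b : R) : a <= b ->
  continuous f -> (forall x : R, is_derive x 1 F (f x)) ->
  \int[lebesgue_measure]_(x in `[a, b]) f x = F b - F a.
Proof. by move=> ab cf dF; rewrite /Rintegral (integral_is_derive ab cf dF). Qed.

End FTC.

(** * Erlang densities *)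

Section Erlang.
Context (R : realType).
Implicit Types (mu s : R) (m : nat).

(** The index is shifted by one: this is the density of a sum of [m.+1] independent exponential
    variables. *)
Definition erlang_pdf mu m s : R :=
  if 0 <= s then mu ^+ m.+1 / m`!%:R * s ^+ m * expR (- mu * s) else 0.

Lemma erlang_pdf_ge0 mu m s : 0 <= mu -> 0 <= erlang_pdf mu m s.
Proof.
move=> mu0; rewrite /erlang_pdf; case: ifPn => // s0.
by rewrite !mulr_ge0 ?exprn_ge0 ?expR_ge0.
Qed.

Lemma measurable_erlang_pdf mu m : measurable_fun setT (erlang_pdf mu m).
Proof.
apply: measurable_fun_ifT => //; first exact: measurable_fun_ler.
apply: measurable_funM.
  by apply: measurable_funM => //; exact: exprn_measurable.
by apply: measurableT_comp => //; exact: measurable_funM.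
Qed.

Lemma exponential_pdf_erlang mu s : exponential_pdf mu s = erlang_pdf mu 0 s.
Proof.
rewrite /erlang_pdf; case: leP => s0.
  by rewrite exponential_pdfE// fact0 expr0 divr1 mulr1 expr1.
by rewrite lt0_exponential_pdf.
Qed.

(** On [[0, v]] the two exponentials multiply to the constant [expR (- mu * v)], which leaves the
    polynomial [(v - y) ^+ m] to integrate; outside it one of the densities vanishes. *)
Lemma erlang_pdf_convolution mu m v :
  (\int[lebesgue_measure]_y (erlang_pdf mu m (v - y) * exponential_pdf mu y)%:E
   = (erlang_pdf mu m.+1 v)%:E)%E.
Proof.
pose f (y : R) : R := mu ^+ m.+2 / m`!%:R * expR (- mu * v) * (v - y) ^+ m.
pose F (y : R) : R := - (mu ^+ m.+2 / m.+1`!%:R * expR (- mu * v)) * (v - y) ^+ m.+1.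
transitivity (\int[lebesgue_measure]_(y in `[0%R, v]) (f y)%:E)%E.
  rewrite [RHS]integral_mkcond/=; apply: eq_integral => y _.
  rewrite exponential_pdf_erlang /erlang_pdf patchE.
  have [|] := boolP (y \in _).
    rewrite inE/= in_itv/= => /andP[y0 yv]; rewrite y0 subr_ge0 yv.
    congr EFin; rewrite fact0 expr0 divr1 mulr1 expr1 /f.
    rewrite (_ : - mu * v = - mu * (v - y) + - mu * y); last by ring.
    rewrite expRD (exprS mu m.+1); ring.
  rewrite notin_setE/= in_itv/= => h; congr EFin; rewrite subr_ge0.
  by case: (leP y v) => yv; case: (leP 0 y) => y0; rewrite ?mul0r ?mulr0//;
    exfalso; apply: h; rewrite y0 yv.
rewrite /erlang_pdf; case: leP => v0; last first.
  by rewrite set_itv_ge ?integral_set0// bnd_simp -ltNge.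
have cf : continuous f by rewrite /f; continuous1.
have dF (x : R) : is_derive x 1 F (f x).
  rewrite /F /f; derive1; rewrite factS natrM; field.
  by rewrite nat1r !pnatr_eq0 -lt0n fact_gt0.
rewrite (integral_is_derive v0 cf dF); congr EFin.
by rewrite /F subrr expr0n/= subr0; ring.
Qed.

End Erlang.

(** * The law of the process *)

Section Laws.
Context d (Omega : measurableType d) (R : realType) (P : probability Omega R).
Local Open Scope ereal_scope.

(** Induction on [m]: the last claim is independent of the sum of the earlier ones, so Tonelli's
    theorem and a translation turn the integral into a convolution of the Erlang and exponential
    densities. *)
Lemma ge0_integral_partial_sum (mu : R) (U : nat -> {RV P >-> R}) (m : nat)
    (f : R -> \bar R) :
  (0 < mu)%R -> iid_exponential mu U ->
  measurable_fun setT f -> (forall x, 0 <= f x) ->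
  \int[P]_w f (partial_sum U m.+1 w) =
  \int[lebesgue_measure]_s (f s * (erlang_pdf mu m s)%:E).
Proof.
move=> mu0 [indU expU].
have intU i (g : R -> \bar R) : measurable_fun setT g -> (forall x, 0 <= g x) ->
    \int[distribution P (U i)]_y g y =
    \int[lebesgue_measure]_y (g y * (exponential_pdf mu y)%:E).
  move=> mg g0.
  rewrite ge0_integral_distribution//.
  apply: ge0_integral_RV_density => //.
  - exact: measurable_exponential_pdf.
  - by move=> x; exact/exponential_pdf_ge0/ltW.
  - exact: expU.
elim: m f => [|m IHm] f mf f0.
  transitivity (\int[distribution P (U 0%N)]_y f y).
    rewrite ge0_integral_distribution//; apply: eq_integral => w _.
    by rewrite /partial_sum big_ord_recl big_ord0 addr0.
  by rewrite intU//; apply: eq_integral => y _; rewrite exponential_pdf_erlang.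
have mD : measurable_fun setT (fun x : R * R => f (x.1 + x.2)%R).
  by apply: measurableT_comp => //; exact: measurable_funD.
pose S := partial_sum U m.+1.
transitivity (\int[P]_w f (S w + U m.+1 w)%R).
  by apply: eq_integral => w _; rewrite /partial_sum big_ord_recr.
rewrite (@ge0_integral_independent _ _ _ _ _ _ _ P S (U m.+1) _
  (fun x : R * R => f (x.1 + x.2)%R))//; last first.
  move=> A B mA mB.
  have := independent_partial_sum indU (n := m.+1) (J := [fset m.+1]%fset)
    (B := fun=> B) (A := A).
  rewrite set_fset1 bigcap_set1; apply => //.
  by move=> i; rewrite inE => /eqP ->.
(* The partial sum becomes the inner variable, where the induction hypothesis applies to a translate
   of [f]. *)
rewrite [LHS](fubini_tonelli (fun x : R * R => f (x.1 + x.2)%R))//=.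
transitivity (\int[distribution P (U m.+1)]_y
    \int[lebesgue_measure]_x (f x * (erlang_pdf mu m (x - y)%R)%:E)).
  apply: eq_integral => y _.
  have mfy : measurable_fun setT (fun x : R => f (x + y)%R).
    by apply: measurableT_comp => //; exact: measurable_funD.
  transitivity (\int[P]_w f (S w + y)%R).
    by rewrite ge0_integral_distribution.
  rewrite (IHm _ mfy (fun x => f0 (x + y)%R)).
  rewrite -(ge0_integral_shift y (f := fun x => f x * (erlang_pdf mu m (x - y)%R)%:E)).
  - by apply: eq_integral => x _; rewrite addrK.
  - apply: emeasurable_funM => //; apply/measurable_EFinP.
    apply: measurableT_comp; first exact: measurable_erlang_pdf.
    exact: measurable_funB.
  - by move=> x; rewrite mule_ge0// lee_fin erlang_pdf_ge0// ltW.
pose g (z : R * R) := f z.1 * (erlang_pdf mu m (z.1 - z.2)%R)%:E *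
   (exponential_pdf mu z.2)%:E.
have mg1 : measurable_fun setT (fun z : R * R =>
    f z.1 * (erlang_pdf mu m (z.1 - z.2)%R)%:E).
  apply: emeasurable_funM; first exact: measurableT_comp.
  apply/measurable_EFinP/(measurableT_comp (measurable_erlang_pdf _ _)).
  exact: measurable_funB.
have g10 (z : R * R) : 0 <= f z.1 * (erlang_pdf mu m (z.1 - z.2)%R)%:E.
  by rewrite mule_ge0// lee_fin erlang_pdf_ge0// ltW.
have mg : measurable_fun setT g.
  apply: emeasurable_funM => //.
  by apply/measurable_EFinP/(measurableT_comp (measurable_exponential_pdf _)).
have g0 z : 0 <= g z.
  by rewrite mule_ge0// lee_fin exponential_pdf_ge0// ltW.
rewrite intU; last 2 first.
(* The same measurability, restated for the display on which Lebesgue measure lives. *)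
- have mg1' : measurable_fun [set: (measurableTypeR R * R)%type]
      (fun z => f z.1 * (erlang_pdf mu m (z.1 - z.2)%R)%:E).
    by move=> mT A mA; exact: (mg1 mT A mA).
  by apply: (@measurable_fun_fubini_tonelli_G _ _ _ _ _ lebesgue_measure _ mg1').
- by move=> y; apply: integral_ge0 => x _; exact: (g10 (x, y)).
transitivity (\int[lebesgue_measure]_y \int[lebesgue_measure]_x g (x, y)).
  apply: eq_integral => y _; rewrite muleC -ge0_integralZl//.
  - by apply: eq_integral => x _; rewrite muleC.
  - exact: (measurableT_comp mg1 (measurable_pair2 y)).
  - by move=> x _; exact: (g10 (x, y)).
  - by rewrite lee_fin exponential_pdf_ge0// ltW.
have mg' : measurable_fun [set: (measurableTypeR R * measurableTypeR R)%type] g.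
  by move=> mT A mA; exact: (mg mT A mA).
rewrite -(@fubini_tonelli _ _ _ _ _ lebesgue_measure lebesgue_measure g mg')//.
apply: eq_integral => x _.
rewrite -erlang_pdf_convolution -ge0_integralZl//.
- by apply: eq_integral => y _; rewrite /g/= EFinM muleA.
- apply/measurable_EFinP; apply: measurable_funM.
    apply: (measurableT_comp (measurable_erlang_pdf _ _)).
    exact: measurable_funB.
  exact: measurable_exponential_pdf.
- move=> y _; rewrite lee_fin mulr_ge0//.
    by rewrite erlang_pdf_ge0// ltW.
  by rewrite exponential_pdf_ge0// ltW.
Qed.

(** [N 0] vanishes only almost surely, so the events on [N t] and on the increment [N t - N 0] are
    compared through integrals of indicators. *)
Lemma poisson_process_marginal (lam : R) (N : R -> {RV P >-> nat}) (t : R) k :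
  (0 < t)%R -> poisson_process lam N ->
  P (N t @^-1` [set k]) = (poisson_pmf (lam * t) k)%:E.
Proof.
move=> t0 [N0 _ /(_ 0%R t k (lexx _) t0) + _]; rewrite subr0 => <-.
have mNt A : measurable (N t @^-1` A) by exact: measurable_funPTI.
have mN0 A : measurable (N 0%R @^-1` A) by exact: measurable_funPTI.
have mD : measurable [set w | (N t w - N 0%R w)%N = k].
  rewrite (_ : [set _ | _] = \bigcup_j (N 0%R @^-1` [set j] `&`
      N t @^-1` [set i | (i - j)%N = k])); last first.
    by apply/seteqP; split=> [w wk|w [j _ [/= <-]]//]; exists (N 0%R w).
  by apply: bigcupT_measurable => j; exact: measurableI.
transitivity (\int[P]_w (\1_(N t @^-1` [set k]) w)%:E).
  by rewrite integral_indic// setIT.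
transitivity (\int[P]_w (\1_[set w | (N t w - N 0%R w)%N = k] w)%:E); last first.
  by rewrite integral_indic// setIT.
apply: ge0_ae_eq_integral => //.
- by apply/measurable_EFinP; exact: measurable_indic.
- by apply/measurable_EFinP; exact: measurable_indic.
- apply: filterS N0 => w Nw _; congr EFin; rewrite !indicE.
  congr (_%:R); congr nat_of_bool.
  by apply/idP/idP; rewrite !inE/= Nw subn0.
Qed.

(** Independence of [N] and [U] is given for generated sigma-algebras. Here each [U i] is read as a
    function on [Omega] with the sigma-algebra generated by the claims, where finite sums remain
    measurable. *)
Lemma generated_partial_sum (U : nat -> {RV P >-> R}) n (A : set R) :
  measurable A ->
  generated_sigma_algebra [set: nat] (fun i w => U i w)
    (partial_sum U n @^-1` A).
Proof.
pose G : set (set Omega) :=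
  \bigcup_(i in [set: nat]) [set U i @^-1` B | B in measurable].
have mU i : measurable_fun setT (U i : g_sigma_algebraType G -> R).
  move=> _ B mB; rewrite setTI; apply: sub_sigma_algebra.
  by exists i => //; exists B.
have mS : measurable_fun setT (partial_sum U n : g_sigma_algebraType G -> R).
  by rewrite /partial_sum; apply: measurable_sum => i; exact: mU.
by move=> mA; have := mS measurableT A mA; rewrite setTI.
Qed.

(** Partition by the number of claims: where [N t] equals [n], the process is
    [p * t - partial_sum U n], and this variable is independent of [N t]. *)
Lemma ge0_integral_cramer_lundberg (p lam mu t : R) (N : R -> {RV P >-> nat})
    (U : nat -> {RV P >-> R}) (f : R -> \bar R) :
  (0 < t)%R -> cramer_lundberg_inputs lam mu N U ->
  measurable_fun setT f -> (forall x, 0 <= f x) ->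
  \int[P]_w f (cramer_lundberg p N U t w) =
  \sum_(n <oo) (poisson_pmf (lam * t) n)%:E *
     \int[P]_w f (p * t - partial_sum U n w)%R.
Proof.
move=> t0 [Npoi _ indep] mf f0.
have mN n : measurable (N t @^-1` [set n]) by exact: measurable_funPTI.
have mfX : measurable_fun setT (fun x : R => f (p * t - x)%R).
  by apply: measurableT_comp => //; exact: measurable_funB.
rewrite [in LHS](_ : setT = \bigcup_n (N t @^-1` [set n])); last first.
  by apply/seteqP; split => // w _; exists (N t w).
rewrite ge0_integral_bigcup//; last 2 first.
- apply: measurable_funTS; apply: (measurableT_comp mf).
  exact: measurable_cramer_lundberg.
- by apply/trivIsetP => i j _ _ ij; apply/seteqP; split=> // w [/= Ni Nj];
    move: ij; rewrite -Ni -Nj eqxx.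
apply: eq_eseriesr => n _.
pose g (z : R * nat) := f (p * t - z.1)%R * (\1_[set n] z.2)%:E.
transitivity (\int[P]_w g (partial_sum U n w, N t w)).
  rewrite integral_mkcond; apply: eq_integral => w _.
  rewrite patchE /g/= indicE; case: ifPn.
    by rewrite inE => /= Nn; rewrite mem_set// mule1 /cramer_lundberg Nn.
  by rewrite notin_setE => /= Nn; rewrite memNset// mule0.
have mI : measurable_fun setT (fun y : nat => (\1_[set n] y)%:E : \bar R).
  by apply/measurable_EFinP; exact: measurable_indic.
rewrite (@ge0_integral_independent _ _ _ _ _ _ _ P (partial_sum U n)
  (N t) _ g)//; last 3 first.
- move=> A B mA mB; rewrite setIC indep; first exact: muleC.
  + apply: sub_sigma_algebra; exists t; first exact: ltW.
    by exists B.
  + exact: generated_partial_sum.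
- apply: emeasurable_funM.
    exact: (measurableT_comp mfX measurable_fst).
  exact: (measurableT_comp mI measurable_snd).
- by move=> z; rewrite mule_ge0// lee_fin.
transitivity (\int[distribution P (partial_sum U n)]_x
   (f (p * t - x)%R * (poisson_pmf (lam * t) n)%:E)).
  apply: eq_integral => x _; rewrite /g/=.
  rewrite ge0_integralZl//.
  congr (_ * _); rewrite integral_indic// setIT.
  exact: poisson_process_marginal.
under eq_integral do rewrite muleC.
rewrite ge0_integralZl//; last by rewrite lee_fin poisson_pmf_ge0.
by congr (_ * _); rewrite ge0_integral_distribution.
Qed.

End Laws.

(** * Incomplete gamma integrals *)

Section Antiderivatives.
Context (R : realType).
Implicit Types (u k x y : R) (n m : nat).

(** Integration by parts raises the exponent by one. An unspecified antiderivative is enough to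
    differentiate expressions that contain [lower_gamma]. *)
Lemma antiderivative_gamma m :
  exists E : R -> R, forall x : R, is_derive x 1 E (expR (- x) * x ^+ m).
Proof.
elim: m => [|m [E dE]].
  exists (fun x => - expR (- x)) => x.
  by derive1; ring.
exists (fun x => m.+1%:R * E x - x ^+ m.+1 * expR (- x)) => x.
by derive1; ring.
Qed.

Lemma lower_gammaE m (E : R -> R) x : 0 <= x ->
  (forall t : R, is_derive t 1 E (expR (- t) * t ^+ m)) ->
  lower_gamma m.+1%:R x = E x - E 0.
Proof.
move=> x0 dE; rewrite -(Rintegral_is_derive x0 _ dE); last by continuous1.
apply: eq_Rintegral => t; rewrite inE/= in_itv/= => /andP[t0 _].
by rewrite -natr1 addrK powR_mulrn.
Qed.

(** Contribution of [m.+1] claims up to constants: [s] is the total claim size, [u - s] the value of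
    [X_r], and [k] is the exponent of the moment plus [mu]. *)
Definition incomplete_moment k u m y : R :=
  \int[lebesgue_measure]_(s in `[0, y]) (expR (- k * s) * s ^+ m * (u - s)).

Lemma integral_incomplete_moment k u m y : 0 <= y ->
  (\int[lebesgue_measure]_(s in `[0%R, y]) (expR (- k * s) * s ^+ m * (u - s))%:E
   = (incomplete_moment k u m y)%:E)%E.
Proof.
move=> y0; rewrite /incomplete_moment /Rintegral fineK//.
apply: integrable_fin_num => //; apply: continuous_compact_integrable.
  exact: segment_compact.
by apply: continuous_subspaceT; continuous1.
Qed.

(** The integral is a combination of the incomplete gamma functions of orders [m + 1] and [m + 2];
    the recurrence [gamma(m+2, x) = (m+1) gamma(m+1, x) - x^(m+1) e^(-x)] removes the second one and
    leaves the boundary term. *)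
Lemma incomplete_momentE k u m y : 0 < k -> 0 <= y ->
  incomplete_moment k u m y =
  ((u * k - m.+1%:R) * lower_gamma m.+1%:R (k * y)
   + (k * y) ^+ m.+1 * expR (- (k * y))) / k ^+ m.+2.
Proof.
move=> k0 y0; have [E dE] := antiderivative_gamma m.
have dEk (s : R) : is_derive s 1 (fun s => E (k * s))
    (k * (expR (- (k * s)) * (k * s) ^+ m)).
  rewrite mulrC; apply: (is_derive1_comp (f := E)); exact: is_derive1_mull.
pose H s := ((u * k - m.+1%:R) * E (k * s)
   + (k * s) ^+ m.+1 * expR (- (k * s))) * (k ^+ m.+2)^-1.
rewrite (lower_gammaE _ dE); last by rewrite mulr_ge0// ltW.
have cf : continuous (fun s => expR (- k * s) * s ^+ m * (u - s)).
  by continuous1.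
have dH (s : R) : is_derive s 1 H (expR (- k * s) * s ^+ m * (u - s)).
  rewrite /H; derive1; rewrite !exprMn (mulNr k s) !exprS.
  have : k ^+ m != 0 by rewrite expf_neq0 ?gt_eqF.
  move: (k ^+ m) (s ^+ m) => km sm km0.
  by field; rewrite km0 gt_eqF.
rewrite /incomplete_moment (Rintegral_is_derive y0 cf dH).
by rewrite /H !mulr0 expr0n/= mul0r addr0; ring.
Qed.

Lemma incomplete_moment_ge0 k u m y : 0 <= y <= u -> 0 <= incomplete_moment k u m y.
Proof.
move=> /andP[y0 yu]; apply: Rintegral_ge0 => s /=.
rewrite in_itv/= => /andP[s0 sy].
by rewrite !mulr_ge0 ?expR_ge0 ?exprn_ge0// subr_ge0 (le_trans sy).
Qed.

Lemma incomplete_moment_le k u m y : 0 <= k -> 0 <= y <= u ->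
  incomplete_moment k u m y <= u * y ^+ m.+1.
Proof.
move=> k0 /andP[y0 yu].
have u0 : 0 <= u by rewrite (le_trans y0).
rewrite (_ : u * _ = u * y ^+ m * y - u * y ^+ m * 0); last by rewrite exprS; ring.
rewrite -lee_fin -integral_incomplete_moment//.
have cf : continuous (fun _ : R => u * y ^+ m) by continuous1.
have dF (s : R) : is_derive s 1 (fun s => u * y ^+ m * s) (u * y ^+ m).
  by derive1; ring.
rewrite -(integral_is_derive y0 cf dF); apply: ge0_le_integral => //=.
  + move=> s; rewrite in_itv/= => /andP[s0 sy]; rewrite lee_fin.
    by rewrite !mulr_ge0 ?expR_ge0 ?exprn_ge0// subr_ge0 (le_trans sy).
  + apply/measurable_EFinP; apply: measurable_funTS.
    by apply: continuous_measurable_fun; continuous1.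

  + move=> s; rewrite in_itv/= => /andP[s0 sy]; rewrite lee_fin.
    rewrite mulrC ler_pM ?mulr_ge0 ?expR_ge0 ?exprn_ge0 ?subr_ge0 ?(le_trans sy)//.
      by rewrite gerBl.
    rewrite -[leRHS]mul1r ler_pM ?expR_ge0 ?exprn_ge0//.
      by rewrite -expR0 ler_expR mulNr oppr_le0 mulr_ge0.
    by rewrite lerXn2r ?nnegrE.
Qed.

(** The Euler beta integral at integer parameters. Each integration by parts trades a factor [u - s]
    for a factor [s]. *)
Lemma antiderivative_beta u n m : exists H : R -> R,
  (forall s : R, is_derive s 1 H ((u - s) ^+ n * s ^+ m)) /\
  H u - H 0 = (n`! * m`!)%:R / (n + m).+1`!%:R * u ^+ (n + m).+1.
Proof.
elim: n m => [|n IHn] m.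
  exists (fun s => s ^+ m.+1 * m.+1%:R^-1); split=> [s|].
    by derive1; field; rewrite nat1r pnatr_eq0.
  rewrite expr0n mul0r subr0 fact0 mul1n add0n factS natrM; field.
  by rewrite nat1r !pnatr_eq0 -lt0n fact_gt0.
have [H [dH HE]] := IHn m.+1.
exists (fun s => ((u - s) ^+ n.+1 * s ^+ m.+1 + n.+1%:R * H s) * m.+1%:R^-1).
split=> [s|].
  by derive1; rewrite /=; field; rewrite nat1r pnatr_eq0.
rewrite subrr !expr0n/= !mul0r !mulr0 !add0r -mulrBl -mulrBr HE.
rewrite addSn addnS !factS !natrM; field.
by apply/and4P; split; rewrite -?natrD ?nat1r -?natrD pnatr_eq0 -?lt0n ?fact_gt0.
Qed.

End Antiderivatives.

(** * Convergent series and their extended-real sums *)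

Section Series.
Context (R : realType).
Implicit Types (x : nat -> R) (y : R).

Lemma eseries_cvg x y : series x @ \oo --> y ->
  (\sum_(n <oo) (x n)%:E = y%:E)%E.
Proof.
move=> xy; rewrite -(cvg_lim _ xy)// -EFin_lim; last by apply/cvg_ex; exists y.
by congr (limn _); apply/funext => n; rewrite /= /series/= sumEFin.
Qed.

Lemma cvg_eseries x y : (forall n, 0 <= x n) ->
  (\sum_(n <oo) (x n)%:E = y%:E)%E -> series x @ \oo --> y.
Proof.
move=> x0 xy; have cx : cvgn (series x) by apply: nnseries_is_cvg; rewrite ?xy ?ltry.
by move/eseries_cvg : (cx); rewrite xy => -[->].
Qed.

Lemma eq_cvg_series x1 x2 y : series x1 @ \oo --> y -> x1 =1 x2 ->
  series x2 @ \oo --> y.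
Proof. by move=> + /funext <-. Qed.

Lemma cvg_exp_series (z : R) : series (fun n => z ^+ n / n`!%:R) @ \oo --> expR z.
Proof. exact: (is_cvg_series_exp_coeff z). Qed.

Lemma cvg_seriesZ x y (c : R) :
  series x @ \oo --> y -> series (fun n => c * x n) @ \oo --> c * y.
Proof.
move=> xy; rewrite (_ : series _ = fun n => c * series x n).
  by apply: cvgM => //; exact: cvg_cst.
by apply/funext => n; rewrite /series/= mulr_sumr.
Qed.

Lemma cvg_seriesB x1 x2 (y1 y2 : R) :
  series x1 @ \oo --> y1 -> series x2 @ \oo --> y2 ->
  series (fun n => x1 n - x2 n) @ \oo --> y1 - y2.
Proof.
move=> xy1 xy2; rewrite (_ : series _ = fun n => series x1 n - series x2 n).
  exact: cvgB.
by apply/funext => n; rewrite /series/= sumrB.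
Qed.

Lemma is_cvg_series_bessel (z : R) : 0 <= z ->
  cvgn (series (fun m => z ^+ m.+1 / (m`! * m.+1`!)%:R)).
Proof.
move=> z0; have ce : cvgn (series (fun m => z * (z ^+ m / m`!%:R))).
  by apply/cvg_ex; exists (z * expR z); exact/cvg_seriesZ/cvg_exp_series.
apply: series_le_cvg ce => n.
- by rewrite divr_ge0 ?exprn_ge0.
- by rewrite mulr_ge0 ?divr_ge0 ?exprn_ge0.
- rewrite exprS -mulrA ler_wpM2l// ler_wpM2l ?exprn_ge0// natrM.
  rewrite lef_pV2 ?posrE ?mulr_gt0 ?ltr0n ?fact_gt0//.
  by rewrite ler_peMr// ler1n fact_gt0.
Qed.

(** Under the integral, [expR (k * u)] combines with [expR (- k * s)] into [expR (k * (u - s))]. Its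
    power series is integrated term by term, as all terms are nonnegative, and each term is a beta
    integral with exponents [n.+1] and [m]. *)
Lemma cvg_series_incomplete_moment (k u : R) m : 0 <= k -> 0 <= u ->
  series (fun n => (k ^+ n * n.+1%:R * m`!%:R / (n + m).+2`!%:R) *
    u ^+ (n + m).+2) @ \oo --> expR (k * u) * incomplete_moment k u m u.
Proof.
move=> k0 u0; apply: cvg_eseries => [n|].
  apply: mulr_ge0; last exact: exprn_ge0.
  by rewrite !mulr_ge0 ?invr_ge0 ?exprn_ge0 ?ler0n.
rewrite EFinM -integral_incomplete_moment//.
rewrite -ge0_integralZl_EFin ?expR_ge0//; last 2 first.
- move=> s /=; rewrite in_itv/= => /andP[s0 su].
  by rewrite lee_fin !mulr_ge0 ?expR_ge0 ?exprn_ge0 ?subr_ge0.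
- apply/measurable_EFinP; apply: measurable_funTS.
  by apply: continuous_measurable_fun; continuous1.
pose h n (s : R) := k ^+ n / n`!%:R * ((u - s) ^+ n.+1 * s ^+ m).
have ch n : continuous (h n) by rewrite /h; continuous1.
transitivity (\int[lebesgue_measure]_(s in `[0%R, u]) (\sum_(n <oo) (h n s)%:E))%E;
  last first.
  apply: eq_integral => s _; rewrite -EFinM.
  rewrite (_ : _ * (_ * (u - s)) = s ^+ m * (u - s) * expR (k * (u - s))); last first.
    by rewrite (mulrBr k) expRD -(mulNr k s); ring.
  rewrite -(eseries_cvg (cvg_seriesZ (c := s ^+ m * (u - s))
    (@cvg_exp_series (k * (u - s))))).
  by apply: eq_eseriesr => n _; congr EFin; rewrite /h exprMn exprS; ring.
rewrite integral_nneseries//; first last.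
- move=> n s /=; rewrite in_itv/= => /andP[s0 su].
  rewrite lee_fin /h; apply: mulr_ge0; first by rewrite divr_ge0 ?exprn_ge0.
  by apply: mulr_ge0; rewrite exprn_ge0 ?subr_ge0.
- move=> n; apply/measurable_EFinP; apply: measurable_funTS.
  exact: continuous_measurable_fun.
apply: eq_eseriesr => n _.
have [H [dH HE]] := antiderivative_beta u n.+1 m.
have dH' (s : R) : is_derive s 1 (fun s => k ^+ n / n`!%:R * H s) (h n s).
  by derive1; rewrite /h; ring.
rewrite (integral_is_derive u0 (ch n) dH') -mulrBr HE; congr EFin.
rewrite addSn !factS !natrM; field.
by apply/and4P; split; rewrite -?natrD ?nat1r -?natrD pnatr_eq0 -?lt0n ?fact_gt0.
Qed.

End Series.

(** * Kendall's identity *)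

Section BallotIdentity.
Context (R : realType).
Implicit Types a b : R.

Lemma exprD_div_fact a b N :
  (a + b) ^+ N / N`!%:R =
  \sum_(i < N.+1) a ^+ (N - i) * b ^+ i / (i`! * (N - i)`!)%:R.
Proof.
rewrite exprDn mulr_suml; apply: eq_bigr => i _.
rewrite -mulr_natr -(bin_fact (leq_ord i)) natrM invfM mulrA -mulrA.
by rewrite -!mulrA [X in _ * (_ * X)]mulrA divff ?mul1r// pnatr_eq0 -lt0n bin_gt0 leq_ord.
Qed.

(** Write the weight [N + 1 - 2k] as [(N + 1 - k) - k]. Each part cancels one factor of a factorial
    and leaves [a], respectively [b], times the binomial expansion of [(a + b) ^+ N]. *)
Lemma signed_ballot_sum a b N :
  \sum_(k < N.+2) (N.+1%:R - k.*2%:R) / (k`! * (N.+1 - k)`!)%:R *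
     (a ^+ (N.+1 - k) * b ^+ k) = (a - b) * ((a + b) ^+ N / N`!%:R).
Proof.
rewrite mulrBl exprD_div_fact !mulr_sumr.
transitivity (
  \sum_(k < N.+2) ((N.+1 - k)%:R / (k`! * (N.+1 - k)`!)%:R *
     (a ^+ (N.+1 - k) * b ^+ k)) -
  \sum_(k < N.+2) (k%:R / (k`! * (N.+1 - k)`!)%:R *
     (a ^+ (N.+1 - k) * b ^+ k)) : R).
  rewrite -sumrB; apply: eq_bigr => k _.
  by rewrite natrB ?leq_ord// -addnn natrD; ring.
congr (_ - _).
  rewrite big_ord_recr/= subnn mul0r mul0r addr0; apply: eq_bigr => i _.
  rewrite subSn ?leq_ord// factS exprS !natrM; field.
  by rewrite ?nat1r !pnatr_eq0 -!lt0n !fact_gt0.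
rewrite big_ord_recl/= mul0r mul0r add0r; apply: eq_bigr => i _.
rewrite /bump leq0n add1n subSS factS exprS !natrM; field.
by rewrite ?nat1r !pnatr_eq0 -!lt0n !fact_gt0.
Qed.

(** Fold the signed sum about its middle: replacing [k] by [N + 1 - k] reverses the sign of the
    weight and exchanges [a] and [b]. Up to the factor [N!], the coefficients are the ballot numbers
    [C(N, k) - C(N, k-1)]. *)
Lemma ballot_sum a b N :
  \sum_(k < N.+1 | (k.*2 <= N)%N)
    (N - k.*2).+1%:R / (k`! * (N - k).+1`!)%:R * (a * b) ^+ k *
    (a ^+ (N - k.*2).+1 - b ^+ (N - k.*2).+1) =
  (a - b) * ((a + b) ^+ N / N`!%:R).
Proof.
rewrite -signed_ballot_sum.
pose x k := (N.+1%:R - k.*2%:R) / (k`! * (N.+1 - k)`!)%:R *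
     (a ^+ (N.+1 - k) * b ^+ k) : R.
pose y k := (N.+1%:R - k.*2%:R) / (k`! * (N.+1 - k)`!)%:R *
     (a ^+ k * b ^+ (N.+1 - k)) : R.
rewrite [RHS](bigID (fun k : 'I_N.+2 => (k.*2 <= N)%N))/=.
have -> : \sum_(k < N.+2 | ~~ (k.*2 <= N)%N) x k =
    - \sum_(k < N.+2 | (k.*2 <= N)%N) y k.
  rewrite (reindex_inj rev_ord_inj)/= big_mkcond -sumrN [RHS]big_mkcond/=.
  apply: eq_bigr => k _; have kN := ltn_ord k.
  have -> : (N.+2 - k.+1 = N.+1 - k)%N by lia.
  have E : (N.+1%:R - (N.+1 - k).*2%:R = - (N.+1%:R - k.*2%:R) :> R).
    by rewrite -!addnn !natrD natrB; [ring|lia].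
  rewrite /x /y E subKn; last lia.
  case: ifPn => h1; case: ifPn => h2 //; last by exfalso; lia.
    by rewrite mulnC !mulNr.
  (* The middle index is fixed by the reflection, and its weight is zero. *)
  have -> : k.*2 = N.+1 by lia.
  by rewrite subrr oppr0 !mul0r.
rewrite -sumrB [RHS]big_mkcond big_ord_recr/= [X in _ + X]ifN; last by lia.
rewrite addr0 big_mkcond; apply: eq_bigr => k _; case: ifPn => // kN.
rewrite /x /y.
have -> : (N.+1 - k = (N - k.*2).+1 + k)%N by lia.
have -> : ((N - k).+1 = (N - k.*2).+1 + k)%N by lia.
have -> : (N.+1%:R - k.*2%:R = (N - k.*2).+1%:R :> R).
  by rewrite -natrB; [congr _%:R; lia|lia].
by rewrite !exprMn !exprD; ring.
Qed.

(** Row [k] is shifted by [2k] and extended by zero, so that interchanging the sums collects the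
    terms with [n + 2k = N]. *)
Lemma double_nneseries_diagonal (f : nat -> nat -> R) :
  (forall k n, 0 <= f k n) ->
  (\sum_(k <oo) \sum_(n <oo) (f k n)%:E =
   \sum_(N <oo) (\sum_(k < N.+1 | (k.*2 <= N)%N) f k (N - k.*2)%N)%:E)%E.
Proof.
move=> f0; pose e k N := if (k.*2 <= N)%N then f k (N - k.*2)%N else 0.
have e0 k N : 0 <= e k N by rewrite /e; case: ifP.
transitivity (\sum_(k <oo) \sum_(N <oo) (e k N)%:E)%E.
  apply: eq_eseriesr => k _.
  transitivity (\sum_(n <oo) (e k (n + k.*2)%N)%:E)%E.
    by apply: eq_eseriesr => n _; rewrite /e leq_addl addnK.
  rewrite (@nneseries_addn _ (fun n => (e k n)%:E)); last by move=> n; rewrite lee_fin.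
  rewrite ereal_series eseries_mkcond; apply: eq_eseriesr => N _.
  by rewrite /e; case: (k.*2 <= N)%N.
rewrite (nneseries_interchange xpredT xpredT); last by move=> k N; rewrite lee_fin.
apply: eq_eseriesr => N _.
rewrite (nneseries_split 0 N.+1); last by move=> k _; rewrite lee_fin.
rewrite add0n [X in (_ + X)%E]eseries0 ?adde0; last first.
  by move=> k Nk _; rewrite /e ifN//; lia.
by rewrite sumEFin big_mkord -big_mkcond.
Qed.

End BallotIdentity.

Section KendallIdentity.
Context (R : realType).
Variables (a b u : R).
Hypotheses (b_gt0 : 0 < b) (ab : b < a) (u_gt0 : 0 < u).

(** Contribution of [k] claims to the two exponential moments, up to a common factor; it is the sum
    of row [k] of the array [d] below. Row 0 comes from the atom of the law. *)
Let D k : R :=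
  if k is m.+1 then u^-1 * ((u * (a * b)) ^+ m.+1 / (m`! * m.+1`!)%:R) *
    (a * (expR (a * u) * incomplete_moment a u m u)
     - b * (expR (b * u) * incomplete_moment b u m u))
  else a * expR (a * u) - b * expR (b * u).

Let d k n : R := (n.+1%:R / (k`! * (n + k).+1`!)%:R * (a * b) ^+ k) *
  (a ^+ n.+1 - b ^+ n.+1) * u ^+ (n + k.*2).

Let d_ge0 k n : 0 <= d k n.
Proof.
have a0 : 0 < a by rewrite (lt_trans b_gt0).
rewrite /d; apply: mulr_ge0; last by rewrite exprn_ge0// ltW.
apply: mulr_ge0; last by rewrite subr_ge0 lerXn2r ?nnegrE ?ltW.
apply: mulr_ge0; last by rewrite exprn_ge0// mulr_ge0 ?ltW.
by rewrite divr_ge0.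
Qed.

Let cvg_d k : series (d k) @ \oo --> D k.
Proof.
have a0 : 0 < a by rewrite (lt_trans b_gt0).
case: k => [|m]; rewrite /D.
  apply: (eq_cvg_series (cvg_seriesB
    (cvg_seriesZ (c := a) (@cvg_exp_series _ (a * u)))
    (cvg_seriesZ (c := b) (@cvg_exp_series _ (b * u))))) => n.
  rewrite /d fact0 mul1n !addn0 expr0 mulr1 factS natrM !exprMn !exprS.
  by field; rewrite nat1r !pnatr_eq0 -!lt0n !fact_gt0.
have H := (cvg_seriesZ (c := u^-1 * ((u * (a * b)) ^+ m.+1 / (m`! * m.+1`!)%:R))
  (cvg_seriesB
    (cvg_seriesZ (c := a) (cvg_series_incomplete_moment (m := m) (ltW a0) (ltW u_gt0)))
    (cvg_seriesZ (c := b) (cvg_series_incomplete_moment (m := m)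
      (ltW b_gt0) (ltW u_gt0))))).
apply: (eq_cvg_series H) => n.
rewrite /d (_ : n + m.+1.*2 = m.+1 + (n + m).+1)%N; last by lia.
rewrite addnS (exprD u) !exprMn !(exprS _ n) (exprS u (n + m).+1).
rewrite natrM (natrM _ m.+1`!); field.
by rewrite !pnatr_eq0 -!lt0n !fact_gt0 gt_eqF.
Qed.

(** The array [d] is nonnegative and may be summed in either order. Rows give the series of [D];
    diagonals give, by [ballot_sum], the power series of [(a - b) * expR ((a + b) * u)]. *)
Lemma cvg_kendall :
  series (fun m => (u * (a * b)) ^+ m.+1 / (m`! * m.+1`!)%:R *
    (a * (expR (a * u) * incomplete_moment a u m u)
     - b * (expR (b * u) * incomplete_moment b u m u))) @ \oo -->
  u * ((a - b) * expR ((a + b) * u) - (a * expR (a * u) - b * expR (b * u))).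
Proof.
have D0 k : 0 <= D k.
  rewrite -lee_fin -(eseries_cvg (@cvg_d k)).
  by apply: nneseries_ge0 => n _ _; rewrite lee_fin.
have : series D @ \oo --> (a - b) * expR ((a + b) * u).
  apply: cvg_eseries => //.
  transitivity (\sum_(k <oo) \sum_(n <oo) (d k n)%:E)%E.
    by apply: eq_eseriesr => k _; rewrite (eseries_cvg (@cvg_d k)).
  rewrite double_nneseries_diagonal//.
  rewrite -(eseries_cvg (cvg_seriesZ (c := a - b) (@cvg_exp_series _ ((a + b) * u)))).
  apply: eq_eseriesr => N _; congr EFin.
  rewrite exprMn mulrAC (mulrA (a - b)) -(ballot_sum a b N) mulr_suml.
  apply: eq_bigr => k kN; rewrite /d.
  have -> : (N - k.*2 + k.*2 = N)%N by lia.
  by have -> : ((N - k.*2 + k).+1 = (N - k).+1)%N by lia.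
(* Removing row 0 and multiplying by [u] brings the series of [D] to the stated form. *)
rewrite -cvg_shiftS => cD.
rewrite (_ : series _ = fun n => u * (series D n.+1 - D 0%N)).
  exact: cvgM (cvg_cst u) (cvgB cD (cvg_cst (D 0%N))).
apply/funext => n; apply/esym.
rewrite /series/= big_nat_recl// addrC addKr mulr_sumr.
apply: eq_bigr => m _.
by rewrite /D -mulrA mulVKf// gt_eqF.
Qed.
End KendallIdentity.

(** * Exponential moments *)

Section ExponentialMoments.
Context (R : realType).

(** The bound [u * y ^+ m.+1] on the moments dominates the series by a Bessel-type one in
    [c * y]. *)
Lemma is_cvg_series_incomplete_moment (c k u y : R) :
  0 <= c -> 0 <= k -> 0 <= y <= u ->
  cvgn (series (fun m => c ^+ m.+1 / (m`! * m.+1`!)%:R *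
                         incomplete_moment k u m y)).
Proof.
move=> c0 k0 yu; have /andP[y0 yu'] := yu; have u0 := le_trans y0 yu'.
have /cvg_ex[l cl] := is_cvg_series_bessel (mulr_ge0 c0 y0).
have cv : cvgn (series (fun m => u * ((c * y) ^+ m.+1 / (m`! * m.+1`!)%:R))).
  by apply/cvg_ex; exists (u * l); exact: cvg_seriesZ.
have t0 m : 0 <= c ^+ m.+1 / (m`! * m.+1`!)%:R by rewrite divr_ge0 ?exprn_ge0.
apply: series_le_cvg cv => m.
- by rewrite mulr_ge0// incomplete_moment_ge0.
- by rewrite mulr_ge0// divr_ge0// exprn_ge0// mulr_ge0.
- rewrite exprMn (_ : u * _ = c ^+ m.+1 / (m`! * m.+1`!)%:R * (u * y ^+ m.+1));
    last by ring.
  by rewrite ler_wpM2l// incomplete_moment_le.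
Qed.

(** Without claims [X_r] equals [p r], where [z / r] is [p]: this gives the term [p]. With [m.+1]
    claims of total size [t], the restriction [X_r >= p r - y] reads [t <= y], and the factor
    [expR (- mu * t)] of the Erlang density adds [mu] to the exponent [s]. *)
Lemma integral_cramer_lundberg_expR d (Omega : measurableType d)
    (P : probability Omega R) (p lam mu r s y : R) (N : R -> {RV P >-> nat})
    (U : nat -> {RV P >-> R}) :
  0 < p -> 0 < lam -> 0 < mu -> 0 < r -> 0 < s + mu -> 0 <= y <= p * r ->
  cramer_lundberg_inputs lam mu N U ->
  (\int[distribution P (cramer_lundberg p N U r)]_(z in `[(p * r - y)%R, +oo[)
     (expR (s * z) * (z / r))%:E =
  (expR (- lam * r) * expR (s * (p * r)) * (p + r^-1 * limn (series (fun m =>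
     (lam * mu * r) ^+ m.+1 / (m`! * m.+1`!)%:R *
     incomplete_moment (s + mu) (p * r) m y))))%:E)%E.
Proof.
move=> p0 lam0 mu0 r0 smu yu NU; have /andP[y0 yu'] := yu.
set u := p * r; have u0 : 0 < u by rewrite mulr_gt0.
set T := fun m => _ * incomplete_moment _ _ m _.
have cT : series T @ \oo --> limn (series T).
  apply: is_cvg_series_incomplete_moment => //; last exact: ltW.
  by rewrite !mulr_ge0// ltW.
(* The restriction is built into the integrand; it is nonnegative because [u - y >= 0]. *)
pose F z := if u - y <= z then expR (s * z) * (z / r) else 0.
have F0 z : 0 <= F z.
  rewrite /F; case: ifPn => // uz; rewrite mulr_ge0 ?expR_ge0// divr_ge0 ?(ltW r0)//.
  by rewrite (le_trans _ uz)// subr_ge0.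
have mF : measurable_fun setT F.
  apply: measurable_fun_ifT => //; first exact: measurable_fun_ler.
  by apply: continuous_measurable_fun; continuous1.
have mEF : measurable_fun setT (EFin \o F) by exact/measurable_EFinP.
transitivity (\int[P]_w (F (cramer_lundberg p N U r w))%:E)%E.
  rewrite integral_mkcond -(@ge0_integral_distribution _ _ _ _ _ _
    (cramer_lundberg p N U r) (EFin \o F))//.
  apply: eq_integral => z _; rewrite patchE /F/=.
  case: ifPn; first by rewrite inE/= in_itv/= andbT => ->.
  rewrite notin_setE/= in_itv/= andbT => /negP; rewrite -ltNge => zu.
  by rewrite leNgt zu.
rewrite (@ge0_integral_cramer_lundberg _ _ _ P p lam mu r N U (EFin \o F))//.
have lr0 : 0 < lam * r by rewrite mulr_gt0.
pose c := expR (- lam * r) * expR (s * u).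
have term0 : ((poisson_pmf (lam * r) 0)%:E *
    \int[P]_w (F (p * r - partial_sum U 0 w))%:E = (c * p)%:E)%E.
  under eq_integral do rewrite /partial_sum big_ord0 subr0.
  rewrite integral_cst// [X in (_ * (_ * X))%E](_ : _ = 1%E); last first.
    exact: probability_setT.
  rewrite mule1 -EFinM; congr EFin.
  rewrite /poisson_pmf lr0 expr0 fact0 invr1 !mul1r /F lerBlDr lerDl y0.
  rewrite /c mulNr -mulrA; congr (_ * (_ * _)).
  by rewrite /u mulfK// gt_eqF.
have iidU : iid_exponential mu U by case: NU.
have termS m : ((poisson_pmf (lam * r) m.+1)%:E *
    \int[P]_w (F (p * r - partial_sum U m.+1 w))%:E = (c * r^-1 * T m)%:E)%E.
  have mFu : measurable_fun setT (fun x : R => (F (u - x))%:E).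
    apply/measurable_EFinP; apply: (measurableT_comp mF).
    exact: measurable_funB.
  rewrite (@ge0_integral_partial_sum _ _ _ P mu U m (fun x : R => (F (u - x))%:E))//;
    last by move=> x; rewrite lee_fin.
  transitivity ((poisson_pmf (lam * r) m.+1)%:E *
    \int[lebesgue_measure]_(t in `[0%R, y])
     ((mu ^+ m.+1 / m`!%:R * expR (s * u) / r)%:E *
      (expR (- (s + mu) * t) * t ^+ m * (u - t))%:E))%E.
    congr (_ * _)%E; rewrite [RHS]integral_mkcond; apply: eq_integral => t _.
    rewrite patchE /F /erlang_pdf -EFinM; have [|] := boolP (t \in _).
      rewrite inE/= in_itv/= => /andP[t0 ty]; rewrite t0 lerD2l lerN2 ty.
      rewrite -EFinM; congr EFin.
      rewrite (_ : - (s + mu) * t = - (s * t) + - mu * t); last by ring.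
      by rewrite (mulrBr s) !expRD; ring.
    rewrite notin_setE/= in_itv/= lerD2l lerN2 => h.
    by case: (leP t y) => ty; case: (leP 0 t) => t0; rewrite ?mul0r ?mulr0//;
      exfalso; apply: h; rewrite t0 ty.
  rewrite ge0_integralZl_EFin//; last 3 first.
  - move=> t /=; rewrite in_itv/= => /andP[t0 ty]; rewrite lee_fin.
    by rewrite !mulr_ge0 ?expR_ge0 ?exprn_ge0// subr_ge0 (le_trans ty).
  - apply/measurable_EFinP; apply: measurable_funTS.
    by apply: continuous_measurable_fun; continuous1.
  - by rewrite !mulr_ge0 ?invr_ge0 ?exprn_ge0 ?expR_ge0 ?ltW.
  rewrite integral_incomplete_moment// -!EFinM; congr EFin.
  rewrite /poisson_pmf lr0 /c /T natrM !exprMn mulNr.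
  by field; rewrite !pnatr_eq0 -!lt0n !fact_gt0 gt_eqF.
pose f n : \bar R := ((poisson_pmf (lam * r) n)%:E *
    \int[P]_w (F (p * r - partial_sum U n w))%:E)%E.
have f0 n : (0 <= f n)%E.
  rewrite mule_ge0 ?lee_fin ?poisson_pmf_ge0//.
  by apply: integral_ge0 => w _; rewrite lee_fin.
transitivity (\sum_(n <oo) f n)%E; first by [].
rewrite (nneseries_split 0 1)// add0n big_nat1 [f 0%N]term0.
rewrite -(@nneseries_addn _ f 1%N)//.
under eq_eseriesr do rewrite addn1 [f _]termS.
rewrite (eseries_cvg (cvg_seriesZ (c := c * r^-1) cT)) -EFinD; congr EFin.
by rewrite /c; ring.
Qed.

End ExponentialMoments.

(** * Scale functions *)

Section Roots.
Context (R : realType) (c lam mu q : R).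
Hypotheses (c_gt0 : 0 < c) (lam_gt0 : 0 < lam) (mu_gt0 : 0 < mu) (q_gt0 : 0 < q).
Local Notation b1 := (root_plus c lam mu q).
Local Notation b2 := (root_minus c lam mu q).

Let disc_gt0 : 0 < root_disc c lam mu q.
Proof. by rewrite ltr_wpDl ?sqr_ge0// !mulr_gt0. Qed.

Lemma root_plusD_minus : c * (b1 + b2) = q + lam - mu * c.
Proof. by rewrite /root_plus /root_minus; field; rewrite gt_eqF. Qed.

Lemma root_plusM_minus : c * (b1 * b2) = - (q * mu).
Proof.
have := sqr_sqrtr (ltW disc_gt0).
rewrite /root_plus /root_minus /root_disc; set s := Num.sqrt _ => sE.
have -> : c * ((q + lam - mu * c + s) / (2 * c) * ((q + lam - mu * c - s) / (2 * c)))
    = ((q + lam - mu * c) ^+ 2 - s ^+ 2) / (4 * c).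
  by field; rewrite gt_eqF.
by rewrite sE; field; rewrite gt_eqF.
Qed.

Lemma root_minus_lt_plus : b2 < b1.
Proof.
rewrite -subr_gt0 (_ : _ - _ = Num.sqrt (root_disc c lam mu q) / c).
  by rewrite divr_gt0// sqrtr_gt0.
by rewrite /root_plus /root_minus; field; rewrite gt_eqF.
Qed.

Lemma root_minus_lt0_plus : b2 < 0 < b1.
Proof.
have b12 := root_minus_lt_plus.
have : b1 * b2 < 0.
  by rewrite -(pmulr_rlt0 _ c_gt0) root_plusM_minus oppr_lt0 mulr_gt0.
case: (ltP 0 b1) => b10; first by rewrite (pmulr_rlt0 _ b10) => ->.
by rewrite ltNge mulr_le0// (le_trans (ltW b12)).
Qed.

(** The quadratic with roots [b1] and [b2] evaluated at [- mu]. For [c = p] it rewrites the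
    Poisson-Erlang weight [lam * mu * r] as [u * (a * b)], in terms of the shifted roots alone. *)
Lemma root_muM : (b1 + mu) * (b2 + mu) = lam * mu / c.
Proof.
have h1 := root_plusD_minus; have h2 := root_plusM_minus.
apply: (mulfI (lt0r_neq0 c_gt0)).
have -> : c * ((b1 + mu) * (b2 + mu)) =
    c * (b1 * b2) + mu * (c * (b1 + b2)) + c * mu ^+ 2 by ring.
by rewrite h1 h2; field; rewrite gt_eqF.
Qed.

Lemma root_minus_mu_gt0 : 0 < b2 + mu.
Proof.
have /andP[_ b10] := root_minus_lt0_plus.
have b1mu : 0 < b1 + mu by rewrite addr_gt0.
by rewrite -(pmulr_rgt0 _ b1mu) root_muM divr_gt0// mulr_gt0.
Qed.

Lemma scaleE x : 0 <= x -> scale c lam mu q x =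
  c^-1 * (coef_plus c lam mu q * expR (b1 * x) - coef_minus c lam mu q * expR (b2 * x)).
Proof. by move=> x0; rewrite /scale ltNge x0. Qed.

Lemma scale_lt0 x : x < 0 -> scale c lam mu q x = 0.
Proof. by rewrite /scale => ->. Qed.

(** For [x > 0] the closed form holds in a neighbourhood; at 0 the scale function jumps from 0 to
    [c^-1]. *)
Lemma derive1_scale x : 0 < x -> (scale c lam mu q)^`()%classic x =
  c^-1 * (coef_plus c lam mu q * b1 * expR (b1 * x)
          - coef_minus c lam mu q * b2 * expR (b2 * x)).
Proof.
move=> x0; set A1 := coef_plus _ _ _ _; set A2 := coef_minus _ _ _ _.
pose f y := c^-1 * (A1 * expR (b1 * y) - A2 * expR (b2 * y)).
have df : is_derive x 1 f (c^-1 * (A1 * b1 * expR (b1 * x) - A2 * b2 * expR (b2 * x))).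
  by rewrite /f; derive1; ring.
rewrite derive1E (@near_eq_derive _ _ _ _ f) ?oner_neq0//.
  exact: derive_val.
near=> y; apply: scaleE; apply: ltW; near: y.
exact: lt_nbhsr.
Unshelve. all: by end_near. Qed.

End Roots.

(** * The gamma and Bessel series of the formula *)

Section GammaSeries.
Context (R : realType).

(** Here [k] and [k'] are the two roots shifted by [mu], in either order, and [u] is [p r]. *)
Definition gamma_series (k k' u y : R) : R :=
  limn (series (fun m => (u * k') ^+ m / (m`! * m.+1`!)%:R *
                 lower_gamma m.+1%:R (k * y) * (u * k - m.+1%:R))).

(** For [z >= 0] this is [sqrt(z) I_1(2 sqrt(z))], with [I_1] the modified Bessel function. *)
Definition bessel_series (z : R) : R :=
  limn (series (fun m => z ^+ m.+1 / (m`! * m.+1`!)%:R)).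

(** Sum [incomplete_momentE] over [m]: the gamma parts form [gamma_series], and the boundary terms
    form [bessel_series]. The gamma series converges as a difference of two convergent series. *)
Lemma lim_series_incomplete_moment (k k' u y : R) :
  0 < k -> 0 < k' -> 0 < u -> 0 <= y <= u ->
  limn (series (fun m => (u * (k * k')) ^+ m.+1 / (m`! * m.+1`!)%:R *
                         incomplete_moment k u m y)) =
  u * k' / k * gamma_series k k' u y +
  expR (- (k * y)) / k * bessel_series (u * (k * k') * y).
Proof.
move=> k0 k'0 u0 yu; have /andP[y0 yu'] := yu.
have kk'0 : 0 <= u * (k * k') by rewrite !mulr_ge0// ltW.
have cT := is_cvg_series_incomplete_moment kk'0 (ltW k0) yu.
have cL := is_cvg_series_bessel (mulr_ge0 kk'0 y0).
rewrite /gamma_series /bessel_series.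
set T := limn _ in cT *; set L := limn _ in cL *; set t := fun m => _ * (_ - _).
have ct : series t @ \oo --> k / (u * k') * (T - expR (- (k * y)) / k * L).
  apply: (eq_cvg_series (cvg_seriesZ (c := k / (u * k'))
    (cvg_seriesB cT (cvg_seriesZ (c := expR (- (k * y)) / k) cL)))) => m.
  rewrite /t (incomplete_momentE _ _ k0 y0) !exprMn !(exprS _ m.+1) !(exprS _ m).
  have : k ^+ m != 0 by rewrite expf_neq0 ?gt_eqF.
  have : (m`! * m.+1`!)%:R != 0 :> R.
    by rewrite pnatr_eq0 -lt0n muln_gt0 !fact_gt0.
  move: (m`! * m.+1`!)%:R (k ^+ m) (k' ^+ m) (u ^+ m) (y ^+ m) (m.+1%:R)
    => M km k'm um ym m1 M0 km0.
  by field; rewrite M0 km0 !gt_eqF.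
by rewrite (cvg_lim _ ct)//; field; rewrite !gt_eqF.
Qed.

End GammaSeries.

(** * Moments at the two roots and their combinations *)

Section WeightedMoments.
Context (R : realType) (p lam mu q r : R).
Hypotheses (p_gt0 : 0 < p) (lam_gt0 : 0 < lam) (mu_gt0 : 0 < mu)
  (q_gt0 : 0 < q) (r_gt0 : 0 < r).
Local Notation qp := (root_plus p lam mu q).
Local Notation qm := (root_minus p lam mu q).
Local Notation Ap := (coef_plus p lam mu q).
Local Notation Am := (coef_minus p lam mu q).
Local Notation u := (p * r).

(* The value of [E(e^(s X_r) X_r / r; X_r >= p r - y)]. *)
Definition weighted_moment (s y : R) : R :=
  expR (- lam * r) * expR (s * u) * (p + r^-1 * limn (series (fun m =>
     (lam * mu * r) ^+ m.+1 / (m`! * m.+1`!)%:R *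
     incomplete_moment (s + mu) u m y))).

Let a := qp + mu.
Let b := qm + mu.

Let b_gt0 : 0 < b. Proof. exact: root_minus_mu_gt0. Qed.
Let ba : b < a. Proof. by rewrite ltrD2r root_minus_lt_plus. Qed.
Let a_gt0 : 0 < a. Proof. exact: lt_trans ba. Qed.
Let u_gt0 : 0 < u. Proof. by rewrite mulr_gt0. Qed.
Let abE : lam * mu * r = u * (a * b).
Proof. by rewrite /a /b root_muM//; field; rewrite gt_eqF. Qed.
Let ApE : Ap = a / (a - b).
Proof. by rewrite /coef_plus /a /b; congr (_ / _); ring. Qed.
Let AmE : Am = b / (a - b).
Proof. by rewrite /coef_minus /a /b; congr (_ / _); ring. Qed.
Let ab_neq0 : a - b != 0. Proof. by rewrite subr_eq0 gt_eqF. Qed.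

Let moment_plusE y : 0 <= y <= u -> weighted_moment qp y =
  expR (- lam * r) * expR (qp * u) *
    (p + r^-1 * (u * b / a * gamma_series a b u y
      + expR (- (a * y)) / a * bessel_series (u * (a * b) * y))).
Proof.
by move=> yu; rewrite /weighted_moment abE (lim_series_incomplete_moment a_gt0 b_gt0).
Qed.

Let moment_minusE y : 0 <= y <= u -> weighted_moment qm y =
  expR (- lam * r) * expR (qm * u) *
    (p + r^-1 * (u * a / b * gamma_series b a u y
      + expR (- (b * y)) / b * bessel_series (u * (a * b) * y))).
Proof.
move=> yu; rewrite /weighted_moment abE [a * b]mulrC.
by rewrite (lim_series_incomplete_moment b_gt0 a_gt0).
Qed.

(** After multiplication by the exponentials, the boundary term of either root carries the same
    [expR (- mu * (x + u))]. Since [Ap / a = Am / b], the two Bessel series cancel. *)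
Lemma weighted_moment_neg x : - u <= x -> x <= 0 ->
  p^-1 * (Ap * expR (qp * x) * weighted_moment qp (u + x)
          - Am * expR (qm * x) * weighted_moment qm (u + x)) =
  expR (- lam * r) *
    (p * scale p lam mu q (x + u)
     + Am * expR (qp * (x + u)) * gamma_series (qp + mu) (qm + mu) u (u + x)
     - Ap * expR (qm * (x + u)) * gamma_series (qm + mu) (qp + mu) u (u + x)).
Proof.
move=> ux x0; have yu : 0 <= u + x <= u.
  by rewrite -lerBlDl sub0r ux gerDl x0.
rewrite -/a -/b moment_plusE// moment_minusE//.
rewrite scaleE; last by rewrite addrC; case/andP: yu.
set Ea := expR (qp * (x + u)); set Eb := expR (qm * (x + u)).
pose M := expR (- mu * (x + u)).
have EaE : Ea = expR (qp * x) * expR (qp * u) by rewrite -expRD -mulrDr.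
have EbE : Eb = expR (qm * x) * expR (qm * u) by rewrite -expRD -mulrDr.
have aE : expR (- (a * (u + x))) = M / Ea.
  by rewrite -expRN -expRD; congr expR; rewrite /a; ring.
have bE : expR (- (b * (u + x))) = M / Eb.
  by rewrite -expRN -expRD; congr expR; rewrite /b; ring.
rewrite aE bE ApE AmE.
transitivity (p^-1 * expR (- lam * r) *
   (a / (a - b) * Ea * (p + r^-1 * (u * b / a * gamma_series a b u (u + x)
      + M / Ea / a * bessel_series (u * (a * b) * (u + x))))
   - b / (a - b) * Eb * (p + r^-1 * (u * a / b * gamma_series b a u (u + x)
      + M / Eb / b * bessel_series (u * (a * b) * (u + x)))))).
  by rewrite EaE EbE; ring.
have : Ea != 0 by rewrite gt_eqF ?expR_gt0.
have : Eb != 0 by rewrite gt_eqF ?expR_gt0.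
move: Ea Eb {EaE EbE aE bE} => Ea Eb Eb0 Ea0.
by field; rewrite ab_neq0 Ea0 Eb0 !gt_eqF.
Qed.

(** The Kendall-type identity [E(W(X_r) X_r / r; X_r >= 0) = e^(q r)], obtained from [cvg_kendall]
    with the shifted roots [a] and [b]. *)
Lemma weighted_moment_scale :
  p^-1 * (Ap * weighted_moment qp u - Am * weighted_moment qm u) = expR (q * r).
Proof.
have u0 : 0 <= u := ltW u_gt0.
have uu : 0 <= u <= u by rewrite u0 lexx.
have ab0 : 0 <= u * (a * b) by rewrite !mulr_ge0// ltW.
have ca := is_cvg_series_incomplete_moment ab0 (ltW a_gt0) uu.
have cb := is_cvg_series_incomplete_moment ab0 (ltW b_gt0) uu.
rewrite /weighted_moment -/a -/b abE ApE AmE.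
set Ta := limn _ in ca *; set Tb := limn _ in cb *.
have K : a * expR (a * u) * Ta - b * expR (b * u) * Tb =
    u * ((a - b) * expR ((a + b) * u) - (a * expR (a * u) - b * expR (b * u))).
  apply: (@cvg_unique _ _ _ _ _ _ _ (cvg_kendall b_gt0 ba u_gt0)) => //.
  apply: (eq_cvg_series (cvg_seriesB (cvg_seriesZ (c := a * expR (a * u)) ca)
    (cvg_seriesZ (c := b * expR (b * u)) cb))) => m.
  by ring.
have abE' : a + b = (q + lam) / p + mu.
  rewrite /a /b addrACA; apply: (mulfI (lt0r_neq0 p_gt0)).
  by rewrite mulrDr root_plusD_minus//; field; rewrite gt_eqF.
pose M := expR (mu * u).
have M0 : M != 0 by rewrite gt_eqF ?expR_gt0.
have aM : expR (a * u) = expR (qp * u) * M by rewrite -expRD -mulrDl.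
have bM : expR (b * u) = expR (qm * u) * M by rewrite -expRD -mulrDl.
(* The sum of the roots gives [(a + b) u = (q + lam) r + mu u]; this is where [q r] appears. *)
have abM : expR ((a + b) * u) = expR (q * r) / expR (- lam * r) * M.
  rewrite -expRN -!expRD abE'; congr expR; field; by rewrite gt_eqF.
have l0 : expR (- lam * r) != 0 by rewrite gt_eqF ?expR_gt0.
apply: (mulIf M0); apply: (mulfI ab_neq0); apply: (mulfI (lt0r_neq0 u_gt0)).
have -> : u * ((a - b) * (expR (q * r) * M)) =
    expR (- lam * r) * (u * ((a - b) * expR ((a + b) * u))).
  by rewrite abM; field.
have -> : u * ((a - b) * expR ((a + b) * u)) =
    a * expR (a * u) * Ta - b * expR (b * u) * Tb
    + u * (a * expR (a * u) - b * expR (b * u)).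
  by rewrite K; ring.
by rewrite aM bM; field; rewrite ab_neq0 !gt_eqF.
Qed.

(** With the extra factors [qp] and [qm] the boundary terms no longer cancel: [Ap qp / a - Am qm / b
    = (qp - qm) / (a - b) = 1], so one Bessel series survives. *)
Lemma weighted_moment_derive1_scale :
  p^-1 * (Ap * qp * weighted_moment qp u - Am * qm * weighted_moment qm u) =
  expR (- lam * r) *
    (p * (scale p lam mu q)^`()%classic u
     + Am * qp * expR (qp * u) * gamma_series (qp + mu) (qm + mu) u u
     - Ap * qm * expR (qm * u) * gamma_series (qm + mu) (qp + mu) u u
     + expR (- mu * u) / u * bessel_series (p * lam * mu * r ^+ 2)).
Proof.
have uu : 0 <= u <= u by rewrite lexx ltW.
have -> : p * lam * mu * r ^+ 2 = u * (a * b) * u by rewrite -abE; ring.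
rewrite -/a -/b moment_plusE// moment_minusE// derive1_scale//.
set Ea := expR (qp * u); set Eb := expR (qm * u); set M := expR (- mu * u).
have aE : expR (- (a * u)) = M / Ea.
  by rewrite -expRN -expRD; congr expR; rewrite /a; ring.
have bE : expR (- (b * u)) = M / Eb.
  by rewrite -expRN -expRD; congr expR; rewrite /b; ring.
rewrite aE bE ApE AmE.
have Ea0 : Ea != 0 by rewrite gt_eqF ?expR_gt0.
have Eb0 : Eb != 0 by rewrite gt_eqF ?expR_gt0.
have -> : qp = a - mu by rewrite /a addrK.
have -> : qm = b - mu by rewrite /b addrK.
move: (gamma_series a b u u) (gamma_series b a u u)
  (bessel_series (u * (a * b) * u)) => t1 t2 l.
by field; rewrite ab_neq0 Ea0 Eb0 !gt_eqF.
Qed.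

End WeightedMoments.

(** * The refracted scale function as a combination of [W] and its derivative *)

Section Refraction.
Context (R : realType).

(** The root equations are solved for [q], [lam] and [p], which leaves a rational identity in free
    variables. The values [e1] and [e2] stay arbitrary, so that it serves for the exponentials at
    [x] and also at 0, where both are 1. *)
Lemma refraction_algebra (c p lam mu q delta b1 b2 s e1 e2 : R) :
  c != 0 -> mu != 0 -> b1 + mu != 0 -> b2 + mu != 0 -> b1 - b2 != 0 ->
  s != 0 -> s + mu != 0 -> s - b1 != 0 -> s - b2 != 0 -> delta = p - c ->
  c * (b1 + b2) = q + lam - mu * c -> c * (b1 * b2) = - (q * mu) ->
  p * s ^+ 2 = (q + lam - mu * p) * s + q * mu ->
  let B1 := (mu + b1) / (b1 - b2) in
  let B2 := (mu + b2) / (b1 - b2) in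
  let w := c^-1 * (B1 * e1 - B2 * e2) in
  let w' := c^-1 * (B1 * b1 * e1 - B2 * b2 * e2) in
  - (delta * s * (c^-1 * (B1 * e1 / (s - b1) - B2 * e2 / (s - b2)))) =
  (c * w - (q + lam) / (mu * lam) * ((q + lam) * w - c * w')) +
  p / (mu * lam) * ((q + lam) * w - c * w') * s.
Proof.
move=> c0 mu0 b1mu b2mu b12 s0 smu sb1 sb2 dE sumE prodE sE.
have qE : q = - (c * (b1 * b2)) / mu by rewrite prodE; field.
have lamE : lam = c * ((b1 + mu) * (b2 + mu)) / mu.
  apply: (mulIf mu0); rewrite divfK//.
  have -> : c * ((b1 + mu) * (b2 + mu)) =
    c * (b1 * b2) + mu * (c * (b1 + b2)) + c * mu ^+ 2 by ring.
  by rewrite sumE prodE; ring.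
have pE : p = ((q + lam) * s + q * mu) / (s * (s + mu)).
  apply: (mulIf (mulf_neq0 s0 smu)); rewrite divfK ?mulf_neq0//.
  have -> : p * (s * (s + mu)) = p * s ^+ 2 + mu * p * s by ring.
  by rewrite sE; ring.
clear sumE prodE sE; subst delta p q lam => /=.
by field; rewrite c0 mu0 b1mu b2mu b12 s0 smu sb1 sb2.
Qed.

End Refraction.

Section RefractedScale.
Context (R : realType) (p delta lam mu q : R).
Hypotheses (lam_gt0 : 0 < lam) (mu_gt0 : 0 < mu) (q_gt0 : 0 < q)
  (delta_gt0 : 0 < delta) (delta_lt_p : delta < p).
Local Notation c := (p - delta).
Local Notation b1 := (root_plus c lam mu q).
Local Notation b2 := (root_minus c lam mu q).
Local Notation B1 := (coef_plus c lam mu q).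
Local Notation B2 := (coef_minus c lam mu q).
Local Notation qp := (root_plus p lam mu q).
Local Notation qm := (root_minus p lam mu q).
Local Notation Ap := (coef_plus p lam mu q).
Local Notation Am := (coef_minus p lam mu q).
Local Notation WY := (scale c lam mu q).

Let c_gt0 : 0 < c. Proof. by rewrite subr_gt0. Qed.
Let p_gt0 : 0 < p. Proof. exact: lt_trans delta_lt_p. Qed.

(** For [x > 0] and [z > 0], [w(x; -z)] is [refraction_intercept x] times [W(z)] plus
    [refraction_slope x] times [W'(z)]. *)
Definition refraction_slope x :=
  p / (mu * lam) * ((q + lam) * WY x - c * WY^`()%classic x).

Definition refraction_intercept x :=
  c * WY x - (q + lam) / (mu * lam) * ((q + lam) * WY x - c * WY^`()%classic x).

(** The equation [psi(s) = q] for the Laplace exponent [psi(s) = p s - lam s / (s + mu)], cleared of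
    its denominator. *)
Definition scale_root s := p * s ^+ 2 = (q + lam - mu * p) * s + q * mu.

Lemma scale_root_plus : scale_root qp.
Proof.
have h1 := root_plusD_minus lam mu q p_gt0.
have h2 := root_plusM_minus lam p_gt0 mu_gt0 q_gt0.
by rewrite /scale_root -h1 -[q * mu]opprK -h2; ring.
Qed.

Lemma scale_root_minus : scale_root qm.
Proof.
have h1 := root_plusD_minus lam mu q p_gt0.
have h2 := root_plusM_minus lam p_gt0 mu_gt0 q_gt0.
by rewrite /scale_root -h1 -[q * mu]opprK -h2; ring.
Qed.

Section OneRoot.
Variables (s x z : R).
Hypotheses (sE : scale_root s) (s0 : s != 0) (smu : 0 < s + mu) (x_gt0 : 0 < x).

(** The quadratic of [Y] evaluated at a root for [X]. The value is nonzero, so the denominators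
    [s - b1] and [s - b2] below make sense. *)
Let sb : c * ((s - b1) * (s - b2)) = - (delta * s * (s + mu)).
Proof.
have h1 := root_plusD_minus lam mu q c_gt0.
have h2 := root_plusM_minus lam c_gt0 mu_gt0 q_gt0.
have -> : c * ((s - b1) * (s - b2)) =
    p * s ^+ 2 - delta * s ^+ 2 - c * (b1 + b2) * s + c * (b1 * b2) by ring.
by rewrite h1 h2 sE; ring.
Qed.

Let sb_neq0 : (s - b1 != 0) && (s - b2 != 0).
Proof.
rewrite -negb_or -mulf_eq0 -(mulrI_eq0 _ (lregP (lt0r_neq0 c_gt0))) sb.
by rewrite oppr_eq0 !mulf_neq0// ?gt_eqF.
Qed.

(** Refraction applied to one exponential. The endpoint [y = x] of the convolution cancels the
    leading [expR (s * (x + z))], and the endpoint [y = 0] supplies the right-hand side. *)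
Lemma refracted_expR : exists G : R -> R,
  (forall y : R, is_derive y 1 G
     (c^-1 * (B1 * expR (b1 * (x - y)) - B2 * expR (b2 * (x - y))) *
      expR (s * (y + z)))) /\
  expR (s * (x + z)) + delta * s * (G x - G 0) =
  (refraction_intercept x + refraction_slope x * s) * expR (s * z).
Proof.
have /andP[sb1 sb2] := sb_neq0.
have /andP[b2_lt0 b1_gt0] := root_minus_lt0_plus lam c_gt0 mu_gt0 q_gt0.
have b2mu := root_minus_mu_gt0 c_gt0 lam_gt0 mu_gt0 q_gt0.
have b12 : b1 - b2 != 0 by rewrite subr_eq0 gt_eqF// (lt_trans b2_lt0).
pose w e1 e2 := c^-1 * (B1 * e1 - B2 * e2).
pose w' e1 e2 := c^-1 * (B1 * b1 * e1 - B2 * b2 * e2).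
have alg e1 e2 :
    - (delta * s * (c^-1 * (B1 * e1 / (s - b1) - B2 * e2 / (s - b2)))) =
    c * w e1 e2 - (q + lam) / (mu * lam) * ((q + lam) * w e1 e2 - c * w' e1 e2)
    + p / (mu * lam) * ((q + lam) * w e1 e2 - c * w' e1 e2) * s.
  exact: (refraction_algebra e1 e2 (lt0r_neq0 c_gt0) (lt0r_neq0 mu_gt0)
    (lt0r_neq0 (addr_gt0 b1_gt0 mu_gt0)) (lt0r_neq0 b2mu) b12 s0 (lt0r_neq0 smu)
    sb1 sb2 (esym (subKr p delta)) (root_plusD_minus lam mu q c_gt0)
    (root_plusM_minus lam c_gt0 mu_gt0 q_gt0) sE).
(* This is [alg] at 0, where [WY] has value [c^-1] and right derivative [(q + lam) / c ^+ 2], so the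
   slope term drops out. *)
have alg1 : delta * s * (c^-1 * (B1 / (s - b1) - B2 / (s - b2))) = - 1.
  have := alg 1 1; have w1 : c * w 1 1 = 1.
    by rewrite /w /coef_plus /coef_minus; field; rewrite b12 gt_eqF.
  have w'1 : (q + lam) * w 1 1 - c * w' 1 1 = 0.
    have -> : (q + lam) * w 1 1 = (q + lam) / c * (c * w 1 1).
      by field; rewrite gt_eqF.
    have -> : q + lam = c * (b1 + b2) + mu * c by rewrite root_plusD_minus//; ring.
    by rewrite w1 /w' /coef_plus /coef_minus; field; rewrite b12 gt_eqF.
  by rewrite w1 w'1 !mulr1 !mulr0 mul0r subr0 addr0 => <-; rewrite opprK.
pose E b y := expR (b * (x - y)).
pose G y := c^-1 * (B1 * E b1 y * (s - b1)^-1 - B2 * E b2 y * (s - b2)^-1)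
  * expR (s * (y + z)).
exists G; split=> [y|].
  by rewrite /G /E; derive1; field; rewrite sb1 sb2 gt_eqF.
have := alg (expR (b1 * x)) (expR (b2 * x)).
rewrite /w /w' -(scaleE c lam mu q (ltW x_gt0)) -(derive1_scale c lam mu q x_gt0).
rewrite -/(refraction_intercept x) -/(refraction_slope x) => <-.
have -> : G x = c^-1 * (B1 / (s - b1) - B2 / (s - b2)) * expR (s * (x + z)).
  by rewrite /G /E subrr !mulr0 expR0 !mulr1.
rewrite mulrBr mulrA alg1 /G /E subr0 add0r; ring.
Qed.

End OneRoot.

Lemma refracted_scale_le0 x a : x <= 0 ->
  refracted_scale p delta lam mu q x a = scale p lam mu q (x - a).
Proof.
rewrite /refracted_scale le_eqVlt => /predU1P[->|->//].
by rewrite ltxx set_itv1 Rintegral_set1 mulr0 addr0.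
Qed.

(** Combine [refracted_expR] at the two roots. As [z > 0], the derivative of [W] is taken only at
    points [y + z > 0], where the closed form holds. *)
Lemma refracted_scale_gt0 x z : 0 < x -> 0 < z ->
  refracted_scale p delta lam mu q x (- z) =
  p^-1 * (Ap * ((refraction_intercept x + refraction_slope x * qp) * expR (qp * z))
   - Am * ((refraction_intercept x + refraction_slope x * qm) * expR (qm * z))).
Proof.
move=> x0 z0.
have /andP[qm_lt0 qp_gt0] := root_minus_lt0_plus lam p_gt0 mu_gt0 q_gt0.
have qmmu := root_minus_mu_gt0 p_gt0 lam_gt0 mu_gt0 q_gt0.
have [G [dG <-]] := refracted_expR z scale_root_plus (lt0r_neq0 qp_gt0)
  (addr_gt0 qp_gt0 mu_gt0) x0.
have [H [dH <-]] := refracted_expR z scale_root_minus (ltr0_neq0 qm_lt0) qmmu x0.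
rewrite /refracted_scale ltNge (ltW x0)/= opprK.
rewrite scaleE; last by rewrite addr_ge0 ?ltW.
pose K y := p^-1 * (Ap * qp * G y - Am * qm * H y).
pose k y := c^-1 * (B1 * expR (b1 * (x - y)) - B2 * expR (b2 * (x - y))) *
  (p^-1 * (Ap * qp * expR (qp * (y + z)) - Am * qm * expR (qm * (y + z)))).
have ck : continuous k by rewrite /k; continuous1.
have dK (y : R) : is_derive y 1 K (k y).
  by rewrite /K /k; derive1; ring.
rewrite (_ : Rintegral _ _ _ = K x - K 0); first by rewrite /K; ring.
rewrite -(Rintegral_is_derive (ltW x0) ck dK).
apply: eq_Rintegral => y; rewrite inE/= in_itv/= => /andP[y0 yx].
rewrite scaleE ?subr_ge0// derive1_scale//.
by rewrite ltr_wpDl.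
Qed.

End RefractedScale.

(** * Integrals against the law of [X_r] *)

Section MomentIntegrals.
Context (R : realType) d (Omega : measurableType d) (P : probability Omega R).
Variables (p lam mu r : R) (N : R -> {RV P >-> nat}) (U : nat -> {RV P >-> R}).
Hypotheses (p_gt0 : 0 < p) (lam_gt0 : 0 < lam) (mu_gt0 : 0 < mu) (r_gt0 : 0 < r)
  (NU : cramer_lundberg_inputs lam mu N U).
Local Notation law := (distribution P (cramer_lundberg p N U r)).

(** Claims are almost surely nonnegative: the Erlang densities vanish on the negative axis, so every
    term of the decomposition by number of claims is zero. *)
Lemma cramer_lundberg_le : law `]p * r, +oo[ = 0%E.
Proof.
pose f (z : R) : \bar R := (\1_`]p * r, +oo[ z)%:E.
have mf : measurable_fun setT f by apply/measurable_EFinP; exact: measurable_indic.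
have f0 z : (0 <= f z)%E by rewrite lee_fin.
transitivity (\int[law]_z f z)%E; first by rewrite integral_indic// setIT.
rewrite (@ge0_integral_distribution _ _ _ _ _ _ (cramer_lundberg p N U r) f)//.
rewrite (@ge0_integral_cramer_lundberg _ _ _ P p lam mu r N U f)//.
apply: eseries0 => n _ _.
have f_le (s : R) : 0 <= s -> f (p * r - s) = 0%E.
  move=> s0; rewrite /f indicE memNset//= in_itv/= andbT.
  by apply/negP; rewrite -leNgt gerBl.
case: n => [|n].
  under eq_integral do rewrite /partial_sum big_ord0 f_le//.
  by rewrite integral0 mule0.
have iidU : iid_exponential mu U by case: NU.
rewrite (@ge0_integral_partial_sum _ _ _ P mu U n (fun s : R => f (p * r - s)))//;
  last first.
  by apply: (measurableT_comp mf); exact: measurable_funB.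
rewrite integral0_eq ?mule0// => s _; rewrite /erlang_pdf.
by case: ifPn => s0; rewrite ?mule0// f_le// mul0e.
Qed.

(** The coefficients may have opposite signs, so linearity needs integrability; it follows from the
    finiteness of the moments of nonnegative integrands. *)
Lemma integral_law_expR (s1 s2 k1 k2 y : R) :
  0 < s1 + mu -> 0 < s2 + mu -> 0 <= y <= p * r ->
  (\int[law]_(z in `[(p * r - y)%R, +oo[)
     ((k1 * expR (s1 * z) + k2 * expR (s2 * z)) * (z / r))%:E =
  (k1 * weighted_moment p lam mu r s1 y + k2 * weighted_moment p lam mu r s2 y)%:E)%E.
Proof.
move=> s1mu s2mu yu; have /andP[y0 yu'] := yu.
have int s : 0 < s + mu ->
    law.-integrable `[(p * r - y)%R, +oo[ (fun z => (expR (s * z) * (z / r))%:E).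
  move=> smu; apply/integrableP; split.
    apply/measurable_EFinP; apply: measurable_funTS.
    by apply: continuous_measurable_fun; continuous1.
  under eq_integral.
    move=> z; rewrite inE/= in_itv/= andbT => uz.
    rewrite ger0_norm; last first.
      rewrite mulr_ge0 ?expR_ge0// divr_ge0 ?(ltW r_gt0)//.
      by rewrite (le_trans _ uz)// subr_ge0.
    over.
  by rewrite (integral_cramer_lundberg_expR p_gt0 lam_gt0 mu_gt0)// ltry.
under eq_integral do rewrite mulrDl EFinD -!mulrA !(EFinM k1) !(EFinM k2).
rewrite integralD//; try exact: integrableZl (int _ _).
rewrite !integralZl//; try exact: int.
by rewrite !(integral_cramer_lundberg_expR p_gt0 lam_gt0 mu_gt0).
Qed.

End MomentIntegrals.

(** * Assembly of the formula on its three ranges *)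

Lemma measurable_scale (R : realType) (c lam mu q : R) :
  measurable_fun setT (scale c lam mu q).
Proof.
apply: measurable_fun_ifT => //; first exact: measurable_fun_ltr.
by apply: continuous_measurable_fun; continuous1.
Qed.

Theorem proposition16 (R : realType) (d : measure_display)
    (Omega : measurableType d) (P : probability Omega R)
    (p lam mu q r delta : R)
    (N : R -> {RV P >-> nat}) (U : nat -> {RV P >-> R})
    (p_gt0 : 0 < p) (lam_gt0 : 0 < lam) (mu_gt0 : 0 < mu)
    (q_gt0 : 0 < q) (r_gt0 : 0 < r)
    (delta_gt0 : 0 < delta) (delta_lt_p : delta < p)
    (NU : cramer_lundberg_inputs lam mu N U) :
  let X := cramer_lundberg p N U in
  let qp := root_plus p lam mu q in
  let qm := root_minus p lam mu q in
  let Ap := coef_plus p lam mu q in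
  let Am := coef_minus p lam mu q in
  let W := scale p lam mu q in
  let WY := scale (p - delta) lam mu q in
  let V := parisian_refracted_scale (P := P) (X r) p delta lam mu q r in
  let C := expR (- lam * r) *
    (p * W^`()%classic (p * r)
     + Am * qp * expR (qp * p * r) *
       limn [series (p * r * (qm + mu)) ^+ m / (m`! * (m.+1)`!)%:R
                    * lower_gamma m.+1%:R ((qp + mu) * p * r)
                    * (p * r * (qp + mu) - m.+1%:R)]_m
     - Ap * qm * expR (qm * p * r) *
       limn [series (p * r * (qp + mu)) ^+ m / (m`! * (m.+1)`!)%:R
                    * lower_gamma m.+1%:R ((qm + mu) * p * r)
                    * (p * r * (qm + mu) - m.+1%:R)]_m
     + expR (- mu * p * r) / (p * r) *
       limn [series (p * lam * mu * r ^+ 2) ^+ m.+1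
                    / (m`! * (m.+1)`!)%:R]_m) in
  [/\ forall x : R, 0 < x ->
        V x = (expR (q * r) * (p - delta) * WY x
               - (mu * lam)^-1
                 * ((q + lam) * WY x - (p - delta) * WY^`()%classic x)
                 * ((q + lam) * expR (q * r) - p * C))%:E,
      forall x : R, - (p * r) <= x -> x <= 0 ->
        V x = (expR (- lam * r) *
          (p * W (x + p * r)
           + Am * expR (qp * (x + p * r)) *
             limn [series (p * r * (qm + mu)) ^+ m / (m`! * (m.+1)`!)%:R
                          * lower_gamma m.+1%:R ((p * r + x) * (qp + mu))
                          * (p * r * (qp + mu) - m.+1%:R)]_m
           - Ap * expR (qm * (x + p * r)) *
             limn [series (p * r * (qp + mu)) ^+ m / (m`! * (m.+1)`!)%:R
                          * lower_gamma m.+1%:R ((p * r + x) * (qm + mu))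
                          * (p * r * (qm + mu) - m.+1%:R)]_m))%:E &
      forall x : R, x < - (p * r) -> V x = 0%E].
Proof.
move=> X qp qm Ap Am W WY V C.
have /andP[qm_lt0 qp_gt0] := root_minus_lt0_plus lam p_gt0 mu_gt0 q_gt0.
have qmmu : 0 < qm + mu := root_minus_mu_gt0 p_gt0 lam_gt0 mu_gt0 q_gt0.
have qpmu : 0 < qp + mu := addr_gt0 qp_gt0 mu_gt0.
have u_gt0 : 0 < p * r by rewrite mulr_gt0.
have VE (x : R) : x <= 0 -> V x = (\int[distribution P (X r)]_(z in `[0%R, +oo[)
    (W (x + z) * (z / r))%:E)%E.
  move=> x0; apply: eq_integral => z _.
  by rewrite (refracted_scale_le0 _ _ _ _ _ _ x0) opprK.
split=> [x x_gt0|x ux x_le0|x xu].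
- pose al := refraction_intercept p delta lam mu q x.
  pose be := refraction_slope p delta lam mu q x.
  (* The range [z >= 0] is written as [z >= p r - y] with [y = p r], the form of the moment
     formula. *)
  transitivity (\int[distribution P (X r)]_(z in `[(p * r - p * r)%R, +oo[)
    ((p^-1 * (Ap * (al + be * qp)) * expR (qp * z)
      + - (p^-1 * (Am * (al + be * qm))) * expR (qm * z)) * (z / r))%:E)%E.
    rewrite subrr; apply: eq_integral => z; rewrite inE/= in_itv/= andbT.
    (* At [z = 0] the weight [z / r] vanishes, which leaves [z > 0]. *)
    rewrite le_eqVlt => /predU1P[<-|z0]; first by rewrite mul0r !mulr0.
    congr EFin; rewrite refracted_scale_gt0// -/al -/be; congr (_ * _).
    rewrite -/qp -/qm -/Ap -/Am.
    move: (expR _) (expR _) al be => e1 e2 {}al {}be.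
    by clear; move: Ap Am qp qm => A1 A2 s1 s2; ring.
  have uu : 0 <= p * r <= p * r by rewrite lexx ltW.
  rewrite (integral_law_expR p_gt0 lam_gt0 mu_gt0 r_gt0 NU _ _ qpmu qmmu uu).
  (* [C] is the integral of [W'(z) z / r] against the law of [X_r], as [e^(q r)] is that of
     [W(z) z / r]; the rest is algebra in the two moments. *)
  have CE : C = p^-1 * (Ap * qp * weighted_moment p lam mu r qp (p * r)
                        - Am * qm * weighted_moment p lam mu r qm (p * r)).
    rewrite (weighted_moment_derive1_scale p_gt0 lam_gt0 mu_gt0 q_gt0 r_gt0).
    rewrite /C /gamma_series /bessel_series !(mulrA _ p r). reflexivity.
  congr EFin; rewrite CE -(weighted_moment_scale p_gt0 lam_gt0 mu_gt0 q_gt0 r_gt0).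
  rewrite /al /be /refraction_intercept /refraction_slope -/qp -/qm -/Ap -/Am -/WY.
  move: (weighted_moment _ _ _ _ _ _) (weighted_moment _ _ _ _ _ _) => I1 I2.
  move: (WY x) (WY^`()%classic x) => w w'.
  clear -p_gt0 lam_gt0 mu_gt0; move: Ap Am qp qm => A1 A2 s1 s2.
  by field; rewrite !gt_eqF.
(* [W (x + z)] vanishes for [z < - x], and [- x] is [p r - y]. *)
- pose y := p * r + x.
  have yu : 0 <= y <= p * r by rewrite /y -lerBlDl sub0r ux gerDl.
  rewrite VE//; transitivity (\int[distribution P (X r)]_(z in `[(p * r - y)%R, +oo[)
    ((p^-1 * (Ap * expR (qp * x)) * expR (qp * z)
      + - (p^-1 * (Am * expR (qm * x))) * expR (qm * z)) * (z / r))%:E)%E.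
    rewrite [LHS]integral_mkcond [RHS]integral_mkcond; apply: eq_integral => z _.
    rewrite !patchE (_ : p * r - y = - x); last by rewrite /y; ring.
    case: (leP (- x) z) => xz.
      have z0 : 0 <= z by rewrite (le_trans _ xz)// oppr_ge0.
      rewrite !mem_set/= ?in_itv/= ?andbT//; congr EFin.
      rewrite /W scaleE; last by rewrite -lerBlDl sub0r.
      rewrite -/qp -/qm -/Ap -/Am !mulrDr !expRD.
      move: (expR _) (expR _) (expR _) (expR _) => e1 e2 e3 e4.
      by clear; move: Ap Am => A1 A2; ring.
    rewrite [in RHS]memNset/=; last first.
      by rewrite in_itv/= andbT; apply/negP; rewrite -ltNge.
    have -> : W (x + z) = 0 by apply: scale_lt0; rewrite -ltrBrDl sub0r.
    by rewrite mul0r; case: ifP.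
  rewrite (integral_law_expR p_gt0 lam_gt0 mu_gt0 r_gt0 NU _ _ qpmu qmmu yu); congr EFin.
  transitivity (p^-1 * (Ap * expR (qp * x) * weighted_moment p lam mu r qp y
                      - Am * expR (qm * x) * weighted_moment p lam mu r qm y)).
    move: (weighted_moment _ _ _ _ _ _) (weighted_moment _ _ _ _ _ _) => I1 I2.
    move: (expR _) (expR _) => e1 e2.
    by clear; move: Ap Am => A1 A2; ring.
  rewrite (weighted_moment_neg p_gt0 lam_gt0 mu_gt0 q_gt0 r_gt0 ux x_le0).
  rewrite /gamma_series !(mulrC _ (p * r + x)); reflexivity.
- rewrite VE; last by rewrite (le_trans (ltW xu))// oppr_le0 ltW.
  (* For [z <= p r] the argument [x + z] is negative and [W] vanishes; beyond [p r] the law has no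
     mass. *)
  transitivity (\int[distribution P (X r)]_(z in `](p * r)%R, +oo[)
    (W (x + z) * (z / r))%:E)%E.
    rewrite [LHS]integral_mkcond [RHS]integral_mkcond; apply: eq_integral => z _.
    rewrite !patchE; case: (ltP (p * r) z) => uz.
      by rewrite !mem_set//= in_itv/= andbT// ltW// (lt_trans u_gt0).
    rewrite [in RHS]memNset/=; last first.
      by rewrite in_itv/= andbT; apply/negP; rewrite -leNgt.
    have -> : W (x + z) = 0.
      by apply: scale_lt0; rewrite -ltrBrDr sub0r (lt_le_trans xu)// lerN2.
    by rewrite mul0r; case: ifP.
  rewrite null_set_integral//; last exact: (cramer_lundberg_le p mu_gt0 r_gt0 NU).
  apply/measurable_EFinP; apply: measurable_funTS; apply: measurable_funM.
    apply: (measurableT_comp (measurable_scale _ _ _ _)).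
    exact: measurable_funD.
  exact: measurable_funM.
Qed.
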